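(* For each of the following 15 pairs of polynomials $(f,g)$ in $\mathbb{Z}[X]$, the hypergeometric monodromy group $\Gamma(f,g)\subset \mathrm{Sp}_4(\Omega)(\mathbb{Z})$ is arithmetic, i.e. $\Gamma(f,g)$ has finite index in $\mathrm{Sp}_4(\Omega)(\mathbb{Z})$, where $\Omega$ is the non-degenerate symplectic form preserved by $\Gamma(f,g)$: 1. $f=X^4+3X^3+4X^2+3X+1$, $g=X^4+2X^2+1$; 2. $f=X^4+2X^3+3X^2+2X+1$, $g=X^4-2X^3+2X^2-2X+1$; 3. $f=X^4+2X^3+3X^2+2X+1$, $g=X^4-3X^3+4X^2-3X+1$; 4. $f=X^4+2X^3+3X^2+2X+1$, $g=X^4-2X^3+3X^2-2X+1$; 5. $f=X^4+2X^3+3X^2+2X+1$, $g=X^4-X^3+2X^2-X+1$; 6. $f=X^4+2X^3+3X^2+2X+1$, $g=X^4-X^3+X^2-X+1$; 7. $f=X^4+3X^3+4X^2+3X+1$, $g=X^4-X^3+2X^2-X+1$; 8. $f=X^4+3X^3+4X^2+3X+1$, $g=X^4-X^2+1$; 9. $f=X^4+2X^2+1$, $g=X^4-3X^3+4X^2-3X+1$; 10. $f=X^4+2X^3+2X^2+2X+1$, $g=X^4-2X^3+3X^2-2X+1$; 11. $f=X^4+3X^3+4X^2+3X+1$, $g=X^4-2X^3+3X^2-2X+1$; 12. $f=X^4+X^3+2X^2+X+1$, $g=X^4-2X^3+3X^2-2X+1$; 13. $f=X^4+X^3+X^2+X+1$, $g=X^4-2X^3+3X^2-2X+1$; 14. $f=X^4+X^3+2X^2+X+1$,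 $g=X^4-3X^3+4X^2-3X+1$; 15. $f=X^4-3X^3+4X^2-3X+1$, $g=X^4-X^2+1$.
   Context: For a monic polynomial $h(X)=X^4+c_3X^3+c_2X^2+c_1X+c_0\in\mathbb{Z}[X]$, its companion matrix is $$\begin{pmatrix}0&0&0&-c_0\\1&0&0&-c_1\\0&1&0&-c_2\\0&0&1&-c_3\end{pmatrix}.$$ Given a pair $(f,g)$ of monic degree four polynomials in $\mathbb{Z}[X]$ that are products of cyclotomic polynomials, have no common root in $\mathbb{C}$, and satisfy $f(0)=g(0)=1$, let $A$ and $B$ be the companion matrices of $f$ and $g$ respectively. The hypergeometric monodromy group $\Gamma(f,g)$ is the subgroup of $\mathrm{SL}_4(\mathbb{Z})$ generated by $A$ and $B$. For each pair listed in the claim, it is known (Beukers and Heckman) that $\Gamma(f,g)$ preserves a non-degenerate integral symplectic (i.e. alternating bilinear) form $\Omega$ on $\mathbb{Z}^4$, which is unique up to scalar multiples, and that $\Gamma(f,g)$ is Zariski dense in the symplectic group $\mathrm{Sp}_4(\Omega)$ of $\Omega$. Here $\mathrm{Sp}_4(\Omega)(\mathbb{Z})$ denotes the group of all matrices $M\in\mathrm{SL}_4(\mathbb{Z})$ preserving $\Omega$, i.e. $\Omega(Mv,Mw)=\Omega(v,w)$ for all $v,w$; it is unchanged when $\Omega$ is replaced by a nonzero scalar multiple. ''Non-degenerate'' means non-degenerate over $\mathbb{Q}$ (it is not required that $\Omega$ be unimodular). *)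

(* Defs.v *)
From mathcomp Require Import all_boot all_order all_algebra.
From mathcomp Require Import mathcomp_extra boolp classical_sets functions.
From mathcomp Require Import cardinality.

Set Implicit Arguments.
Unset Strict Implicit.
Unset Printing Implicit Defensive.

Import GRing.Theory Num.Theory.
Local Open Scope classical_set_scope.
Local Open Scope ring_scope.

(* This is the transpose of the convention of [companionmx] in mxpoly, and the
   dimension is 4 by definition rather than [(size h).-1].  The leading
   coefficient is not read: only meant for monic [h] of degree 4. *)
Definition companion4 (h : {poly int}) : 'M[int]_4 :=
  \matrix_(i, j) if j == 3%N :> nat then - h`_i else (i == j.+1 :> nat)%:R.

Definition SL4Z : set 'M[int]_4 := [set M | \det M = 1].

(* [invmx M] is the true inverse here, since [\det M = 1] is a unit. *)
Definition subgroup_SL4Z (H : set 'M[int]_4) : Prop :=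
  [/\ H `<=` SL4Z,
      H 1%:M,
      forall M N, H M -> H N -> H (M *m N)
    & forall M, H M -> H (invmx M)].

(* When [S] is not contained in [SL4Z] the family of subgroups containing it is
   empty and this is the full set; [companion4_SL4Z] rules this out below. *)
Definition generated_subgroup (S : set 'M[int]_4) : set 'M[int]_4 :=
  smallest subgroup_SL4Z S.

Definition hypergeometric_group (f g : {poly int}) : set 'M[int]_4 :=
  generated_subgroup [set companion4 f; companion4 g].

Lemma companion4_SL4Z (h : {poly int}) : h`_0 = 1 -> SL4Z (companion4 h).
Proof.
move=> h0; rewrite /SL4Z /= (expand_det_row _ 0) !big_ord_recr big_ord0 /=.
rewrite !mxE /= !mul0r !add0r h0 /cofactor /= mulrA.
rewrite (_ : row' _ _ = 1%:M) ?det1 ?mulr1; first by [].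
by apply/matrixP => -[[|[|[|]]] // ?] [[|[|[|]]] // ?]; rewrite !mxE.
Qed.

(* The bilinear form on R^4 with Gram matrix [Om]; over Z every integral
   bilinear form arises from a unique [Om]. *)
Definition bform (R : comNzRingType) (Om : 'M[R]_4) (v w : 'cV[R]_4) : R :=
  (v^T *m Om *m w) 0 0.

Definition alternating (Om : 'M[int]_4) : Prop := forall v, bform Om v v = 0.

Definition nondegenerate_over_Q (Om : 'M[int]_4) : Prop :=
  forall v : 'cV[rat]_4,
    (forall w, bform (map_mx intr Om) v w = 0) -> v = 0.

Definition preserves (Om M : 'M[int]_4) : Prop :=
  forall v w, bform Om (M *m v) (M *m w) = bform Om v w.

Definition Sp4Z (Om : 'M[int]_4) : set 'M[int]_4 :=
  [set M | SL4Z M /\ preserves Om M].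

Definition invariant_symplectic_form (G : set 'M[int]_4) (Om : 'M[int]_4) :=
  [/\ alternating Om, nondegenerate_over_Q Om
    & forall M, G M -> preserves Om M].

Definition left_coset (M : 'M[int]_4) (H : set 'M[int]_4) : set 'M[int]_4 :=
  [set M *m N | N in H].

Definition finite_index (H G : set 'M[int]_4) : Prop :=
  H `<=` G /\ finite_set [set left_coset M H | M in G].

Definition hypergeometric_pairs : seq ({poly int} * {poly int}) :=
  [:: ('X^4 + 3 *: 'X^3 + 4 *: 'X^2 + 3 *: 'X + 1,
       'X^4 + 2 *: 'X^2 + 1);
      ('X^4 + 2 *: 'X^3 + 3 *: 'X^2 + 2 *: 'X + 1,
       'X^4 - 2 *: 'X^3 + 2 *: 'X^2 - 2 *: 'X + 1);
      ('X^4 + 2 *: 'X^3 + 3 *: 'X^2 + 2 *: 'X + 1,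
       'X^4 - 3 *: 'X^3 + 4 *: 'X^2 - 3 *: 'X + 1);
      ('X^4 + 2 *: 'X^3 + 3 *: 'X^2 + 2 *: 'X + 1,
       'X^4 - 2 *: 'X^3 + 3 *: 'X^2 - 2 *: 'X + 1);
      ('X^4 + 2 *: 'X^3 + 3 *: 'X^2 + 2 *: 'X + 1,
       'X^4 - 'X^3 + 2 *: 'X^2 - 'X + 1);
      ('X^4 + 2 *: 'X^3 + 3 *: 'X^2 + 2 *: 'X + 1,
       'X^4 - 'X^3 + 'X^2 - 'X + 1);
      ('X^4 + 3 *: 'X^3 + 4 *: 'X^2 + 3 *: 'X + 1,
       'X^4 - 'X^3 + 2 *: 'X^2 - 'X + 1);
      ('X^4 + 3 *: 'X^3 + 4 *: 'X^2 + 3 *: 'X + 1,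
       'X^4 - 'X^2 + 1);
      ('X^4 + 2 *: 'X^2 + 1,
       'X^4 - 3 *: 'X^3 + 4 *: 'X^2 - 3 *: 'X + 1);
      ('X^4 + 2 *: 'X^3 + 2 *: 'X^2 + 2 *: 'X + 1,
       'X^4 - 2 *: 'X^3 + 3 *: 'X^2 - 2 *: 'X + 1);
      ('X^4 + 3 *: 'X^3 + 4 *: 'X^2 + 3 *: 'X + 1,
       'X^4 - 2 *: 'X^3 + 3 *: 'X^2 - 2 *: 'X + 1);
      ('X^4 + 'X^3 + 2 *: 'X^2 + 'X + 1,
       'X^4 - 2 *: 'X^3 + 3 *: 'X^2 - 2 *: 'X + 1);
      ('X^4 + 'X^3 + 'X^2 + 'X + 1,
       'X^4 - 2 *: 'X^3 + 3 *: 'X^2 - 2 *: 'X + 1);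
      ('X^4 + 'X^3 + 2 *: 'X^2 + 'X + 1,
       'X^4 - 3 *: 'X^3 + 4 *: 'X^2 - 3 *: 'X + 1);
      ('X^4 - 3 *: 'X^3 + 4 *: 'X^2 - 3 *: 'X + 1,
       'X^4 - 'X^2 + 1)].

(* Main.v *)
Require Import Defs.
From Stdlib Require Import ZArith.
From HB Require Import structures.
From mathcomp Require Import all_boot all_order all_algebra.
From mathcomp Require Import boolp classical_sets functions cardinality.
From mathcomp Require Import ssrZ zify ring.

(** Let Om be the invariant form. The matrix A^-1 B - 1 has rank one, so Gamma contains a
    power of a transvection along each vector of the Gamma-orbit of its image. A short
    search in this orbit finds, up to scaling, a symplectic basis e1, e2, f1, f2 of Q^4 and a
    vector off the axes in each of the planes <e1,e2>, <e1,f2>, <e2,f1>, <f1,f2>; the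
    corresponding transvections generate root elements of Sp4 for all eight roots. It
    remains to see that a subgroup of Sp4(Z) containing the n-th powers of all elementary
    root elements has finite index.
    - Each of the three standard SL2(Z) (two for long roots, one in the Siegel Levi factor)
      normalizes the group generated by the n-th powers of the root elements in two opposite
      unipotent radicals, and this group contains the (2n^2)-th powers of all root elements
      by the commutator formulas. As Sp4(Z) is a product of boundedly many such SL2(Z) by
      the Euclidean algorithm, the subgroup contains a normal subgroup E of Sp4(Z)
      containing the m-th powers of all root elements, for some m > 0.
    - An element of one of the SL2(Z) that is 1 modulo m commutes modulo E with these
      unipotent radicals, which generate Sp4(Z); so the center of Sp4(Z)/E has finite index.
    - A group generated by finitely many torsion elements whose center has finite index is
      finite, by the transfer homomorphism to the center. *)

Set Implicit Arguments.
Unset Strict Implicit.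
Unset Printing Implicit Defensive.

Import GRing.Theory Num.Theory.
Local Open Scope ring_scope.

(** * Subgroups and finite covers by cosets *)

Section Groups.
Local Open Scope group_scope.
Variable G : groupType.
Implicit Types (x y z g : G) (A B H N E : G -> Prop).

Record is_subgroup H : Prop := IsSubgroup {
  subg1 : H 1;
  subgM : forall x y, H x -> H y -> H (x * y);
  subgV : forall x, H x -> H x^-1 }.

Record is_normal N : Prop := IsNormal {
  normal_subgroup : is_subgroup N;
  normalJ : forall x y, N x -> N (x ^ y) }.

Definition generated A : G -> Prop :=
  fun x => forall H, is_subgroup H -> (forall y, A y -> H y) -> H x.

Definition generates A : Prop :=
  forall H, is_subgroup H -> (forall y, A y -> H y) -> forall x, H x.

Definition finite_cover A H : Prop :=
  exists F : seq G, forall x, A x -> exists2 f, f \in F & H (f^-1 * x).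

Definition central_mod E : G -> Prop := fun x => forall y, E [~ x, y].

Lemma subgX H x n : is_subgroup H -> H x -> H (x ^+ n).
Proof.
move=> sH Hx; elim: n => [|n IHn]; first by rewrite expg0; apply: subg1.
by rewrite expgS; apply: subgM.
Qed.

Lemma generated_is_subgroup A : is_subgroup (generated A).
Proof.
split=> [H sH _|x y Ax Ay H sH AH|x Ax H sH AH]; first exact: subg1.
  exact: (subgM sH (Ax H sH AH) (Ay H sH AH)).
exact: (subgV sH (Ax H sH AH)).
Qed.

Lemma mem_generated A x : A x -> generated A x.
Proof. by move=> Ax H _; apply. Qed.

Lemma conj_subgroup H g : is_subgroup H -> is_subgroup (fun x => H (x ^ g)).
Proof.
move=> sH; split=> [|x y Hx Hy|x Hx]; first by rewrite conj1g; apply: subg1.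
  by rewrite conjMg; apply: subgM.
by rewrite conjVg; apply: subgV.
Qed.

Definition normal_closure A : G -> Prop :=
  generated (fun z => exists x y, A x /\ z = x ^ y).

Lemma normal_closure_normal A : is_normal (normal_closure A).
Proof.
have sN := @generated_is_subgroup (fun z => exists x y, A x /\ z = x ^ y).
split=> // z g Nz; apply: (Nz (fun z => _ (z ^ g))); first exact: conj_subgroup sN.
move=> _ [x [y [Ax ->]]]; apply: mem_generated; exists x, (y * g).
by rewrite conjgM.
Qed.

Lemma sub_normal_closure A x : A x -> normal_closure A x.
Proof. by move=> Ax; apply: mem_generated; exists x, 1; rewrite conjg1. Qed.

Lemma finite_cover_sub A B H K :
  (forall x, B x -> A x) -> (forall x, H x -> K x) ->
  finite_cover A H -> finite_cover B K.
Proof.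
move=> sBA sHK [F FP]; exists F => x /sBA/FP[f Ff Hf].
by exists f => //; apply: sHK.
Qed.

Lemma finite_cover_mul A B N : is_normal N ->
  finite_cover A N -> finite_cover B N ->
  finite_cover (fun x => exists a b, [/\ A a, B b & x = a * b]) N.
Proof.
move=> nN [F FP] [F' FP']; exists [seq f * f' | f <- F, f' <- F'].
move=> _ [a [b [/FP[f Ff Nf] /FP'[f' Ff' Nf'] ->]]].
exists (f * f'); first by apply/allpairsP; exists (f, f').
have ->: (f * f')^-1 * (a * b) = (f^-1 * a) ^ f' * (f'^-1 * b).
  by rewrite conjgE invgM !mulgA mulgK.
by apply: subgM => //; [apply: normal_subgroup|apply: normalJ].
Qed.

Lemma finite_cover_color (T : finType) (c : G -> T) A H :
  (forall x y, A x -> A y -> c x = c y -> H (x^-1 * y)) -> finite_cover A H.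
Proof.
move=> cP; pose rep t := xget 1 [set x | A x /\ c x = t].
exists [seq rep t | t : T] => x Ax; exists (rep (c x)).
  by apply: map_f; rewrite mem_enum.
have [Ar cr] : A (rep (c x)) /\ c (rep (c x)) = c x.
  by apply: (@xgetPex _ 1 [set y | A y /\ c y = c x]); exists x.
exact: cP.
Qed.

Lemma central_mod_normal E : is_normal E -> is_normal (central_mod E).
Proof.
move=> nE; have sE := normal_subgroup nE; split; first split=> [y|x x' Zx Zx' y|x Zx y].
- by rewrite comm1g; apply: subg1.
- have ->: [~ x * x', y] = [~ x, y] ^ x' * [~ x', y].
    by rewrite !commgEl !conjgE !invgM !mulgA !(mulgK, mulgVK).
  by apply: subgM => //; apply: normalJ.
- have ->: [~ x^-1, y] = ([~ x, y]^-1) ^ x^-1.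
    by rewrite !commgEl !conjgE !invgM !invgK !mulgA !(mulgK, mulgVK, mulgV, mul1g).
  by apply: normalJ => //; apply: subgV.
- move=> x y Zx z; have ->: [~ x ^ y, z] = [~ x, z ^ y^-1] ^ y.
    by rewrite conjRg conjgKV.
  exact: normalJ.
Qed.

End Groups.

(** * Groups whose center has finite index *)

Section Schur.
Local Open Scope group_scope.
Variable Q : groupType.
Implicit Types (x y z g c : Q).

Definition is_central c : bool := `[< forall y, commute c y >].

Lemma is_centralP c : reflect (forall y, c * y = y * c) (is_central c).
Proof. exact: asboolP. Qed.

Lemma is_central1 : is_central 1.
Proof. by apply/is_centralP => y; rewrite mulg1 mul1g. Qed.

Lemma is_centralM c d : is_central c -> is_central d -> is_central (c * d).
Proof.
move=> /is_centralP Cc /is_centralP Cd; apply/is_centralP => y.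
by rewrite -mulgA (Cd y) !mulgA (Cc y).
Qed.

Lemma is_centralV c : is_central c -> is_central c^-1.
Proof.
move=> /is_centralP Cc; apply/is_centralP => y.
by apply: (mulgI c); rewrite mulVKg mulgA Cc mulgK.
Qed.

Definition center := {c : Q | is_central c}.
Definition center1 : center := Sub 1 is_central1.
Definition centerM (c d : center) : center :=
  Sub (val c * val d) (is_centralM (valP c) (valP d)).

Lemma centerMA : associative centerM.
Proof. by move=> c d e; apply: val_inj; rewrite /= mulgA. Qed.
Lemma centerMC : commutative centerM.
Proof. by move=> c d; apply: val_inj; rewrite /=; move/is_centralP: (valP c). Qed.
Lemma center1M : left_id center1 centerM.
Proof. by move=> c; apply: val_inj; rewrite /= mul1g. Qed.
HB.instance Definition _ :=
  Monoid.isComLaw.Build center center1 centerM centerMA centerMC center1M.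

Variable F : seq Q.
Hypothesis FP : forall x, exists2 f, f \in F & is_central (f^-1 * x).

Let rep (x : Q) : Q := xget 1 [set u | is_central (u^-1 * x)].

Let rep_central x : is_central ((rep x)^-1 * x).
Proof.
have [f _ fx] := FP x.
by apply: (@xgetPex _ 1 [set u | is_central (u^-1 * x)]); exists f.
Qed.

Let repM x c : is_central c -> rep (x * c) = rep x.
Proof.
move=> Cc; congr xget; apply/seteqP; split=> u /=; rewrite mulgA => h.
  by rewrite -[u^-1 * x](mulgK c); apply: is_centralM => //; apply: is_centralV.
exact: is_centralM.
Qed.

Let rep_eq x y : is_central (x^-1 * y) -> rep x = rep y.
Proof. by move=> h; rewrite -(repM x h) mulVKg. Qed.

Let repK x : rep (rep x) = rep x.
Proof. exact: rep_eq. Qed.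

Let rep_inj x y : rep x = rep y -> is_central (x^-1 * y).
Proof.
move=> e; have -> : x^-1 * y = ((rep x)^-1 * x)^-1 * ((rep y)^-1 * y).
  by rewrite e invgM invgK !mulgA mulgK.
by apply: is_centralM => //; apply: is_centralV.
Qed.

Let T : seq Q := undup (map rep F).

Let rep_T x : rep x \in T.
Proof.
have [f Ff fx] := FP x; rewrite mem_undup; apply/mapP; exists f => //.
by apply/esym/rep_eq.
Qed.

Let T_rep f : f \in T -> rep f = f.
Proof. by rewrite mem_undup => /mapP[x _ ->]; exact: repK. Qed.

Let cocycle x f : center := Sub ((rep (x * f))^-1 * (x * f)) (rep_central _).

Let transfer x : center := \big[centerM/center1]_(f <- T) cocycle x f.

Let perm_T x : perm_eq [seq rep (x * f) | f <- T] T.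
Proof.
have uT : uniq T by apply: undup_uniq.
apply: uniq_perm => //; first rewrite map_inj_in_uniq // => f f' Tf Tf' e.
  rewrite -(T_rep Tf) -(T_rep Tf'); apply: rep_eq.
  by move/rep_inj: e; rewrite invgM mulgA mulgVK.
move=> u; apply/mapP/idP => [[f _ ->]//|Tu].
exists (rep (x^-1 * u)) => //; rewrite -[LHS]T_rep //; apply: rep_eq.
by have := is_centralV (rep_central (x^-1 * u)); rewrite !invgM !invgK -mulgA.
Qed.

Let transferM x y : transfer (x * y) = centerM (transfer x) (transfer y).
Proof.
rewrite /transfer -[X in centerM X _](perm_big _ (perm_T y)) big_map -big_split /=.
apply: eq_bigr => f _; apply: val_inj => /=.
have -> : rep (x * rep (y * f)) = rep (x * y * f).
  by apply: rep_eq; rewrite invgM -mulgA mulgA !mulgA mulgVK -mulgA.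
by rewrite !mulgA mulgK.
Qed.

Let transfer_central (c : center) :
  val (transfer (val c)) = val c ^+ size T.
Proof.
have Cc := valP c.
rewrite /transfer (eq_big_seq (fun=> c)) /=; last first.
  move=> f Tf; apply: val_inj => /=; move/is_centralP: (Cc) => Cf.
  by rewrite Cf repM // T_rep // mulKg.
by elim: (T) => [|t s IHs]; rewrite ?big_nil ?big_cons //= expgS IHs.
Qed.

Variables (gs : seq Q) (r : nat).
Hypotheses (r_gt0 : (0 < r)%N) (gs_gen : generates (fun x => x \in gs)).
Hypothesis gs_torsion : forall g, g \in gs -> g ^+ r = 1.

Let transfer_torsion x : val (transfer x) ^+ r = 1.
Proof.
have comm z y : commute (val (transfer z)) y by apply/is_centralP/valP.
have t1 : val (transfer 1) = 1.
  have := transfer_central center1; rewrite /= => ->; exact: expg1n.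
have tM z y : val (transfer (z * y)) = val (transfer z) * val (transfer y).
  by rewrite transferM.
move: x; apply: gs_gen; first split=> [|x y tx ty|x tx].
- by rewrite t1 expg1n.
- by rewrite tM expgMn // tx ty mulg1.
- by have := tM x^-1 x; rewrite mulVg t1 => /(congr1 (fun z => z ^+ r));
    rewrite expgMn // tx mulg1 expg1n.
move=> g /gs_torsion gr.
have -> : val (transfer g) ^+ r = val (transfer (g ^+ r)).
  elim: (r) => [|k IHk]; first by rewrite !expg0 t1.
  by rewrite [LHS]expgS IHk -tM -expgS.
by rewrite gr t1.
Qed.

Let N := (size T * r)%N.

Let central_torsion c : is_central c -> c ^+ N = 1.
Proof.
move=> Cc; have := transfer_torsion (val (Sub c Cc : center)).
by rewrite transfer_central SubK expgnA.
Qed.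

Let N_gt0 : (0 < N)%N.
Proof. by rewrite muln_gt0 r_gt0 lt0n size_eq0; have:= rep_T 1; case: (T). Qed.

Let powers (s : seq Q) : seq Q :=
  foldr (fun c acc => [seq c ^+ k * y | k <- iota 0 N, y <- acc]) [:: 1] s.

Let powersM (s : seq Q) c y : {in s, forall d, is_central d} ->
  c \in s -> y \in powers s -> c * y \in powers s.
Proof.
elim: s y => // a s IHs y Cs; rewrite inE => cs /allpairsP[[k z] /= [kN zs ->]].
have Ca : is_central a by apply: Cs; rewrite mem_head.
move: cs; have [-> _|ca /= cs] := eqVneq c a; last first.
  apply/allpairsP; exists (k, c * z); split=> //=.
    by apply: IHs => // d ds; apply: Cs; rewrite inE ds orbT.
  by move/is_centralP: (Cs c (mem_behead (s := a :: s) cs)) => Cc; rewrite !mulgA Cc.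
apply/allpairsP; exists (k.+1 %% N, z)%N; split=> //=.
  by rewrite mem_iota /= add0n ltn_mod.
rewrite mulgA -expgS {1}(divn_eq k.+1 N) expgnDr mulnC expgnA.
by rewrite central_torsion // expg1n mul1g.
Qed.

(* The transfer onto the center is the power map on the center, and it kills a power of
   every generator, so the center has finite exponent; it is generated by the finitely
   many values of the cocycle. *)
Theorem center_finite_index_finite : exists s : seq Q, forall x, x \in s.
Proof.
pose cs := [seq val (cocycle g f) | g <- gs, f <- T].
have csC : {in cs, forall d, is_central d}.
  by move=> d /allpairsP[[g f] /= [_ _ ->]]; apply: (valP (cocycle g f)).
pose Y := [seq f * y | f <- T, y <- powers cs].
have gY g y : g \in gs -> y \in Y -> g * y \in Y.
  move=> gg /allpairsP[[f z] /= [Tf zs ->]]; apply/allpairsP.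
  exists (rep (g * f), val (cocycle g f) * z); split=> //=.
    by apply: powersM => //; apply/allpairsP; exists (g, f).
  by rewrite !mulgA mulgV mul1g.
have gXY g n y : g \in gs -> y \in Y -> g ^+ n * y \in Y.
  move=> gg Yy; elim: n => [|n IHn]; first by rewrite expg0 mul1g.
  by rewrite expgS -mulgA; apply: gY.
have allY : forall x, (forall y, y \in Y -> x * y \in Y) /\
                      (forall y, y \in Y -> x^-1 * y \in Y).
  apply: gs_gen; first split=> [|x y [Yx YVx] [Yy YVy]|x [Yx YVx]].
  - by split=> y; rewrite ?invg1 mul1g.
  - by split=> z Yz; rewrite ?invgM -mulgA; [apply/Yx/Yy|apply/YVy/YVx].
  - by rewrite invgK.
  move=> g gg; split=> y Yy; first exact: gY.
  suff -> : g^-1 = g ^+ r.-1 by apply: gXY.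
  by apply: mulg1_eq; rewrite -expgS prednK // gs_torsion.
have [y0 Yy0] : exists y, y \in Y.
  exists (rep 1 * 1); apply/allpairsP; exists (rep 1, 1); split=> //=.
  elim: (cs) => [|a s IHs]; first by rewrite mem_head.
  by apply/allpairsP; exists (0%N, 1); rewrite mem_iota /= expg0 mul1g.
exists [seq y * y0^-1 | y <- Y] => x; apply/mapP; exists (x * y0); last by rewrite mulgK.
by have [+ _] := allY x; apply.
Qed.

End Schur.

Section Quotient.
Local Open Scope group_scope.
Variables (G : groupType) (E : G -> Prop).
Hypothesis nE : is_normal E.
Implicit Types x y z : G.

Let sE : is_subgroup E := normal_subgroup nE.

Definition coset_rep x : G := xget 1 [set u | E (x^-1 * u)].

Lemma coset_repP x : E (x^-1 * coset_rep x).
Proof.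
apply: (@xgetPex _ 1 [set u | E (x^-1 * u)]).
by exists x => /=; rewrite mulVg; apply: subg1.
Qed.

Lemma coset_repE x y : (coset_rep x = coset_rep y) <-> E (x^-1 * y).
Proof.
split=> [e|Exy].
  have := subgM sE (coset_repP x) (subgV sE (coset_repP y)).
  by rewrite e invgM invgK mulgA mulgK.
congr xget; apply/seteqP; split=> u /= Eu.
  by have := subgM sE (subgV sE Exy) Eu; rewrite invgM invgK mulgA mulgK.
by have := subgM sE Exy Eu; rewrite mulgA mulgK.
Qed.

Lemma coset_repK x : coset_rep (coset_rep x) = coset_rep x.
Proof. exact/esym/coset_repE/coset_repP. Qed.

Lemma coset_repMl x y : coset_rep (coset_rep x * y) = coset_rep (x * y).
Proof.
apply/esym/coset_repE; have := normalJ nE y (coset_repP x).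
by rewrite conjgE invgM !mulgA.
Qed.

Lemma coset_repMr x y : coset_rep (x * coset_rep y) = coset_rep (x * y).
Proof.
apply/esym/coset_repE.
by rewrite invgM mulgA -(mulgA _ _ x) mulVg mulg1; apply: coset_repP.
Qed.

Definition quotient := {x : G | coset_rep x == x}.
HB.instance Definition _ := SubChoice.on quotient.

Definition quo x : quotient := exist _ (coset_rep x) (introT eqP (coset_repK x)).

Lemma quo_eq x y : (quo x = quo y) <-> E (x^-1 * y).
Proof.
split=> [/(congr1 val)/coset_repE//|/coset_repE e]; exact: val_inj.
Qed.

Lemma quoK (u : quotient) : quo (val u) = u.
Proof. by apply: val_inj; apply/eqP; apply: (valP u). Qed.

Definition quoM (u v : quotient) : quotient := quo (val u * val v).
Definition quoV (u : quotient) : quotient := quo (val u)^-1.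

Lemma quo_mul x y : quoM (quo x) (quo y) = quo (x * y).
Proof. by apply: val_inj; rewrite /= coset_repMl coset_repMr. Qed.

Lemma quoMA : associative quoM.
Proof.
by move=> u v w; rewrite -(quoK u) -(quoK v) -(quoK w) !quo_mul mulgA.
Qed.
Lemma quo1M : left_id (quo 1) quoM.
Proof. by move=> u; rewrite -(quoK u) quo_mul mul1g. Qed.
Lemma quoM1 : right_id (quo 1) quoM.
Proof. by move=> u; rewrite -(quoK u) quo_mul mulg1. Qed.
Lemma quo_inv x : quoV (quo x) = quo x^-1.
Proof.
apply/quo_eq; rewrite invgK /=.
have := normalJ nE x^-1 (coset_repP x).
by rewrite conjgE invgK !mulgA mulgV mul1g.
Qed.
Lemma quoVM : left_inverse (quo 1) quoV quoM.
Proof. by move=> u; rewrite -(quoK u) quo_inv quo_mul mulVg. Qed.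
Lemma quoMV : right_inverse (quo 1) quoV quoM.
Proof. by move=> u; rewrite -(quoK u) quo_inv quo_mul mulgV. Qed.
HB.instance Definition _ := isGroup.Build quotient quoMA quo1M quoM1 quoVM quoMV.

Lemma quo_morphM x y : quo (x * y) = quo x * quo y.
Proof. by rewrite -quo_mul. Qed.

Lemma quo_morphV x : quo x^-1 = (quo x)^-1.
Proof. by rewrite -quo_inv. Qed.

Lemma quo_morphX x n : quo (x ^+ n) = quo x ^+ n.
Proof. by elim: n => // n IHn; rewrite !expgS quo_morphM IHn. Qed.

Lemma quo_eq1 x : E x -> quo x = 1.
Proof. by move=> Ex; apply/quo_eq; rewrite mulg1; apply: subgV. Qed.

Theorem central_finite_index_finite_index (gs : seq G) (r : nat) :
  (0 < r)%N -> generates (fun x => x \in gs) ->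
  (forall g, g \in gs -> E (g ^+ r)) ->
  finite_cover (fun=> True) (central_mod E) -> finite_cover (fun=> True) E.
Proof.
move=> r_gt0 gs_gen gs_tors [F FP].
have FPQ (u : quotient) : exists2 f, f \in map quo F & is_central (f^-1 * u).
  have [f Ff Zf] := FP (val u) I; exists (quo f); first exact: map_f.
  apply/is_centralP => v; rewrite -(quoK u) -(quoK v) -quo_morphV.
  rewrite -(quo_morphM f^-1) -(quo_morphM (val v)) -(quo_morphM (f^-1 * val u)).
  apply/esym/quo_eq.
  by have := Zf (val v); rewrite commgEl conjgE !invgM !mulgA.
have genQ : generates (fun u => u \in map quo gs).
  move=> H sH Hgs u; rewrite -(quoK u); move: (val u).
  apply: (gs_gen (fun x => H (quo x))) => [|g gg]; last exact/Hgs/map_f.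
  split=> [|x y|x]; first exact: (subg1 sH).
    by rewrite quo_morphM; apply: subgM.
  by rewrite quo_morphV; apply: subgV.
have [s sP] : exists s : seq quotient, forall u, u \in s.
  apply: (center_finite_index_finite FPQ r_gt0 genQ).
  by move=> _ /mapP[g /gs_tors Eg ->]; rewrite -quo_morphX quo_eq1.
exists (map val s) => x _; exists (val (quo x)); first exact: map_f.
by apply/quo_eq; rewrite quoK.
Qed.

End Quotient.

(** * The group Sp4(Z) and its root elements *)

Definition mk4 (a00 a01 a02 a03 a10 a11 a12 a13
                a20 a21 a22 a23 a30 a31 a32 a33 : int) : 'M[int]_4 :=
  \matrix_(i, j) nth 0 (nth [::] [:: [:: a00; a01; a02; a03];
                                     [:: a10; a11; a12; a13];
                                     [:: a20; a21; a22; a23];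
                                     [:: a30; a31; a32; a33]] i) j.

Lemma mk4_inj a00 a01 a02 a03 a10 a11 a12 a13 a20 a21 a22 a23 a30 a31 a32 a33
              b00 b01 b02 b03 b10 b11 b12 b13 b20 b21 b22 b23 b30 b31 b32 b33 :
  mk4 a00 a01 a02 a03 a10 a11 a12 a13 a20 a21 a22 a23 a30 a31 a32 a33 =
  mk4 b00 b01 b02 b03 b10 b11 b12 b13 b20 b21 b22 b23 b30 b31 b32 b33 ->
  [/\ [/\ a00 = b00, a01 = b01, a02 = b02 & a03 = b03],
      [/\ a10 = b10, a11 = b11, a12 = b12 & a13 = b13],
      [/\ a20 = b20, a21 = b21, a22 = b22 & a23 = b23] &
      [/\ a30 = b30, a31 = b31, a32 = b32 & a33 = b33]].
Proof.
pose o k (h : (k < 4)%N) := Ordinal h.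
move/matrixP => e.
have := e (o 0%N isT) (o 0%N isT); have := e (o 0%N isT) (o 1%N isT).
have := e (o 0%N isT) (o 2%N isT); have := e (o 0%N isT) (o 3%N isT).
have := e (o 1%N isT) (o 0%N isT); have := e (o 1%N isT) (o 1%N isT).
have := e (o 1%N isT) (o 2%N isT); have := e (o 1%N isT) (o 3%N isT).
have := e (o 2%N isT) (o 0%N isT); have := e (o 2%N isT) (o 1%N isT).
have := e (o 2%N isT) (o 2%N isT); have := e (o 2%N isT) (o 3%N isT).
have := e (o 3%N isT) (o 0%N isT); have := e (o 3%N isT) (o 1%N isT).
have := e (o 3%N isT) (o 2%N isT); have := e (o 3%N isT) (o 3%N isT).
by rewrite !mxE /=.
Qed.

Lemma mk4_ex (M : 'M[int]_4) :
  exists a00 a01 a02 a03 a10 a11 a12 a13 a20 a21 a22 a23 a30 a31 a32 a33,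
  M = mk4 a00 a01 a02 a03 a10 a11 a12 a13 a20 a21 a22 a23 a30 a31 a32 a33.
Proof.
pose o k (h : (k < 4)%N) := Ordinal h.
pose m i j (hi : (i < 4)%N) (hj : (j < 4)%N) := M (o i hi) (o j hj).
exists (m 0 0 isT isT)%N, (m 0 1 isT isT)%N, (m 0 2 isT isT)%N, (m 0 3 isT isT)%N.
exists (m 1 0 isT isT)%N, (m 1 1 isT isT)%N, (m 1 2 isT isT)%N, (m 1 3 isT isT)%N.
exists (m 2 0 isT isT)%N, (m 2 1 isT isT)%N, (m 2 2 isT isT)%N, (m 2 3 isT isT)%N.
exists (m 3 0 isT isT)%N, (m 3 1 isT isT)%N, (m 3 2 isT isT)%N, (m 3 3 isT isT)%N.
by apply/matrixP => -[[|[|[|[|i]]]] hi] [[|[|[|[|j]]]] hj] //;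
  rewrite mxE /=; congr (M _ _); apply: val_inj.
Qed.

Lemma mk4M a00 a01 a02 a03 a10 a11 a12 a13 a20 a21 a22 a23 a30 a31 a32 a33
           b00 b01 b02 b03 b10 b11 b12 b13 b20 b21 b22 b23 b30 b31 b32 b33 :
  mk4 a00 a01 a02 a03 a10 a11 a12 a13 a20 a21 a22 a23 a30 a31 a32 a33 *m
  mk4 b00 b01 b02 b03 b10 b11 b12 b13 b20 b21 b22 b23 b30 b31 b32 b33 =
  mk4 (a00 * b00 + a01 * b10 + a02 * b20 + a03 * b30)
      (a00 * b01 + a01 * b11 + a02 * b21 + a03 * b31)
      (a00 * b02 + a01 * b12 + a02 * b22 + a03 * b32)
      (a00 * b03 + a01 * b13 + a02 * b23 + a03 * b33)
      (a10 * b00 + a11 * b10 + a12 * b20 + a13 * b30)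
      (a10 * b01 + a11 * b11 + a12 * b21 + a13 * b31)
      (a10 * b02 + a11 * b12 + a12 * b22 + a13 * b32)
      (a10 * b03 + a11 * b13 + a12 * b23 + a13 * b33)
      (a20 * b00 + a21 * b10 + a22 * b20 + a23 * b30)
      (a20 * b01 + a21 * b11 + a22 * b21 + a23 * b31)
      (a20 * b02 + a21 * b12 + a22 * b22 + a23 * b32)
      (a20 * b03 + a21 * b13 + a22 * b23 + a23 * b33)
      (a30 * b00 + a31 * b10 + a32 * b20 + a33 * b30)
      (a30 * b01 + a31 * b11 + a32 * b21 + a33 * b31)
      (a30 * b02 + a31 * b12 + a32 * b22 + a33 * b32)
      (a30 * b03 + a31 * b13 + a32 * b23 + a33 * b33).
Proof.
by apply/matrixP => -[[|[|[|[|i]]]] hi] [[|[|[|[|j]]]] hj] //;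
  rewrite !mxE !big_ord_recr big_ord0 /= !mxE /= add0r.
Qed.

Lemma mk4T a00 a01 a02 a03 a10 a11 a12 a13 a20 a21 a22 a23 a30 a31 a32 a33 :
  (mk4 a00 a01 a02 a03 a10 a11 a12 a13 a20 a21 a22 a23 a30 a31 a32 a33)^T =
  mk4 a00 a10 a20 a30 a01 a11 a21 a31 a02 a12 a22 a32 a03 a13 a23 a33.
Proof.
by apply/matrixP => -[[|[|[|[|i]]]] hi] [[|[|[|[|j]]]] hj] //; rewrite !mxE.
Qed.

Lemma mk4_1 : 1%:M = mk4 1 0 0 0  0 1 0 0  0 0 1 0  0 0 0 1.
Proof.
by apply/matrixP => -[[|[|[|[|i]]]] hi] [[|[|[|[|j]]]] hj] //; rewrite !mxE.
Qed.

Definition J4 : 'M[int]_4 := mk4 0 0 1 0  0 0 0 1  (-1) 0 0 0  0 (-1) 0 0.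

Lemma mul_J4_tr : J4 *m J4^T = 1%:M.
Proof. by rewrite /J4 mk4T mk4M mk4_1; congr mk4; ring. Qed.

Lemma mul_tr_J4 : J4^T *m J4 = 1%:M.
Proof. exact/mulmx1C/mul_J4_tr. Qed.

Definition is_sp4 (M : 'M[int]_4) : bool := M^T *m J4 *m M == J4.

Definition sp4 := {M : 'M[int]_4 | is_sp4 M}.
HB.instance Definition _ := SubChoice.on sp4.

Definition sp4_elt (M : 'M[int]_4) (h : is_sp4 M) : sp4 := exist _ M h.

Definition sp4_mx (g : sp4) : 'M[int]_4 := val g.

Lemma sp4_mx_inj : injective sp4_mx. Proof. exact: val_inj. Qed.

Lemma sp4_mxP (g : sp4) : (sp4_mx g)^T *m J4 *m sp4_mx g = J4.
Proof. exact/eqP/(valP g). Qed.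

Lemma is_sp4_1 : is_sp4 1%:M.
Proof. by rewrite /is_sp4 trmx1 mul1mx mulmx1. Qed.

Lemma is_sp4_mul (g h : sp4) : is_sp4 (sp4_mx g *m sp4_mx h).
Proof.
apply/eqP; rewrite trmx_mul !mulmxA -(mulmxA _ (sp4_mx g)^T) -(mulmxA _ _ (sp4_mx g)).
by rewrite sp4_mxP sp4_mxP.
Qed.

Definition inv_mx (g : sp4) := J4^T *m (sp4_mx g)^T *m J4.

Lemma inv_mx_mul g : inv_mx g *m sp4_mx g = 1%:M.
Proof.
by rewrite /inv_mx -!mulmxA (mulmxA _ J4) sp4_mxP mul_tr_J4.
Qed.

Lemma mul_inv_mx g : sp4_mx g *m inv_mx g = 1%:M.
Proof. exact/mulmx1C/inv_mx_mul. Qed.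

Lemma is_sp4_inv g : is_sp4 (inv_mx g).
Proof.
have e : sp4_mx g *m J4^T *m (sp4_mx g)^T = J4^T.
  have := congr1 (fun M => M *m J4^T) (mul_inv_mx g).
  by rewrite mul1mx /inv_mx -!mulmxA mul_J4_tr mulmx1 !mulmxA.
have e' : sp4_mx g *m J4 *m (sp4_mx g)^T = J4.
  by have := congr1 trmx e; rewrite !trmx_mul !trmxK mulmxA.
apply/eqP; rewrite /inv_mx !trmx_mul !trmxK !mulmxA.
rewrite -(mulmxA _ J4 J4^T) mul_J4_tr mulmx1.
by rewrite -!mulmxA (mulmxA (sp4_mx g)) (mulmxA _ _ J4) e' mulmxA mul_tr_J4 mul1mx.
Qed.

Definition sp4_one : sp4 := exist _ 1%:M is_sp4_1.
Definition sp4_mul g h : sp4 := exist _ (sp4_mx g *m sp4_mx h) (is_sp4_mul g h).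
Definition sp4_inv g : sp4 := exist _ (inv_mx g) (is_sp4_inv g).

Lemma sp4_mulA : associative sp4_mul.
Proof. by move=> g h k; apply: val_inj; rewrite /= /sp4_mx /= mulmxA. Qed.
Lemma sp4_mul1g : left_id sp4_one sp4_mul.
Proof. by move=> g; apply: val_inj; rewrite /= /sp4_mx /= mul1mx. Qed.
Lemma sp4_mulg1 : right_id sp4_one sp4_mul.
Proof. by move=> g; apply: val_inj; rewrite /= /sp4_mx /= mulmx1. Qed.
Lemma sp4_mulVg : left_inverse sp4_one sp4_inv sp4_mul.
Proof. by move=> g; apply: val_inj; exact: inv_mx_mul. Qed.
Lemma sp4_mulgV : right_inverse sp4_one sp4_inv sp4_mul.
Proof. by move=> g; apply: val_inj; exact: mul_inv_mx. Qed.
HB.instance Definition _ :=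
  isGroup.Build sp4 sp4_mulA sp4_mul1g sp4_mulg1 sp4_mulVg sp4_mulgV.

Lemma sp4_mxM (g h : sp4) : sp4_mx (g * h)%g = sp4_mx g *m sp4_mx h.
Proof. by []. Qed.

Lemma sp4_mx1 : sp4_mx 1%g = 1%:M.
Proof. by []. Qed.

Lemma sp4_rel (g : sp4) a00 a01 a02 a03 a10 a11 a12 a13
                        a20 a21 a22 a23 a30 a31 a32 a33 :
  sp4_mx g = mk4 a00 a01 a02 a03 a10 a11 a12 a13 a20 a21 a22 a23 a30 a31 a32 a33 ->
  [/\ [/\ a00 * a21 + a10 * a31 - a20 * a01 - a30 * a11 = 0,
          a00 * a22 + a10 * a32 - a20 * a02 - a30 * a12 = 1 &
          a00 * a23 + a10 * a33 - a20 * a03 - a30 * a13 = 0],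
      [/\ a01 * a22 + a11 * a32 - a21 * a02 - a31 * a12 = 0 &
          a01 * a23 + a11 * a33 - a21 * a03 - a31 * a13 = 1] &
      a02 * a23 + a12 * a33 - a22 * a03 - a32 * a13 = 0].
Proof.
move=> e; have := sp4_mxP g; rewrite e mk4T /J4 !mk4M => /mk4_inj.
case=> [[_ h01 h02 h03] [_ _ h12 h13] [_ _ _ h23] _].
split; [split; [rewrite -[RHS]h01|rewrite -[RHS]h02|rewrite -[RHS]h03]
       |split; [rewrite -[RHS]h12|rewrite -[RHS]h13]|rewrite -[RHS]h23]; ring.
Qed.

(* [E1], [E2], [E12], [D12] are the positive roots 2e1, 2e2, e1+e2, e1-e2, and
   [F1], [F2], [F12], [D21] their opposites. *)
Inductive rootC2 := E1 | E2 | E12 | D12 | F1 | F2 | F12 | D21.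

Definition root_mx (r : rootC2) (t : int) : 'M[int]_4 :=
  match r with
  | E1  => mk4 1 0 t 0  0 1 0 0  0 0 1 0  0 0 0 1
  | E2  => mk4 1 0 0 0  0 1 0 t  0 0 1 0  0 0 0 1
  | E12 => mk4 1 0 0 t  0 1 t 0  0 0 1 0  0 0 0 1
  | D12 => mk4 1 t 0 0  0 1 0 0  0 0 1 0  0 0 (- t) 1
  | F1  => mk4 1 0 0 0  0 1 0 0  t 0 1 0  0 0 0 1
  | F2  => mk4 1 0 0 0  0 1 0 0  0 0 1 0  0 t 0 1
  | F12 => mk4 1 0 0 0  0 1 0 0  0 t 1 0  t 0 0 1
  | D21 => mk4 1 0 0 0  t 1 0 0  0 0 1 (- t)  0 0 0 1
  end.

Lemma root_mx_sp4 r t : is_sp4 (root_mx r t).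
Proof.
by case: r; apply/eqP; rewrite /root_mx mk4T /J4 !mk4M; congr mk4; ring.
Qed.

Definition root_elt r t : sp4 := sp4_elt (root_mx_sp4 r t).

Lemma sp4_mx_root r t : sp4_mx (root_elt r t) = root_mx r t.
Proof. by []. Qed.

Ltac sp4_ring :=
  apply: sp4_mx_inj; rewrite !sp4_mxM ?sp4_mx_root ?sp4_mx1 ?mk4_1 /root_mx ?mk4M;
  congr mk4; ring.

Lemma root_eltD r s t : (root_elt r s * root_elt r t)%g = root_elt r (s + t).
Proof. by case: r; sp4_ring. Qed.

Lemma root_elt0 r : root_elt r 0 = 1%g.
Proof. by apply: sp4_mx_inj; rewrite sp4_mx1 mk4_1; case: r; rewrite /= ?oppr0. Qed.

Lemma root_eltN r t : root_elt r (- t) = (root_elt r t)^-1%g.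
Proof. by apply/esym/mulg1_eq; rewrite root_eltD subrr root_elt0. Qed.

Lemma root_eltX r t k : (root_elt r t ^+ k)%g = root_elt r (t *+ k).
Proof.
elim: k => [|k IHk]; first by rewrite mulr0n root_elt0.
by rewrite expgS IHk root_eltD mulrS.
Qed.

Lemma subg_root (H : sp4 -> Prop) r n t : is_subgroup H ->
  H (root_elt r n) -> H (root_elt r (n * t)).
Proof.
move=> sH Hn; case: (intP t) => [|k|k]; first by rewrite mulr0 root_elt0; apply: subg1.
  by rewrite -mulrzz -pmulrn -root_eltX; apply: subgX.
by rewrite mulrN root_eltN -mulrzz -pmulrn -root_eltX; apply: subgV => //; apply: subgX.
Qed.

Lemma sl2_ind (P : int -> int -> int -> int -> Prop) :
  P 1 0 0 1 ->
  (forall t a b c d, P a b c d -> P (a + t * c) (b + t * d) c d) ->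
  (forall t a b c d, P a b c d -> P a b (c + t * a) (d + t * b)) ->
  forall a b c d, a * d - b * c = 1 -> P a b c d.
Proof.
move=> P1 Pup Plow.
have P0 a b d : a * d = 1 -> P a b 0 d.
  move=> ad; have [[-> ->]|[-> ->]] : a = 1 /\ d = 1 \/ a = -1 /\ d = -1.
  - have := congr1 absz ad; rewrite abszM => /eqP; rewrite muln_eq1 => /andP[/eqP a1 /eqP d1].
    have ha : a = 1 \/ a = -1 by lia.
    have hd : d = 1 \/ d = -1 by lia.
    by case: ha hd ad => [->|->] [->|->]; lia.
  - by have := Pup b _ _ _ _ P1; congr P; ring.
  have := Pup (- b) _ _ _ _ (Pup (-1) _ _ _ _ (Plow 1 _ _ _ _ (Pup (-2) _ _ _ _
            (Plow 1 _ _ _ _ (Pup (-1) _ _ _ _ P1))))).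
  by congr P; ring.
suff H n a b c d : (`|c| < n)%N -> a * d - b * c = 1 -> P a b c d.
  by move=> a b c d; apply: (H `|c|.+1%N).
elim: n a b c d => // n IHn a b c d cn abcd.
have [c0|c0] := eqVneq c 0; first by rewrite c0 in abcd *; apply: P0; rewrite -abcd; ring.
set r := (a %% c)%Z; set q := (a %/ c)%Z.
have aE : a = q * c + r by apply: divz_eq.
suff : P r (b - q * d) c d by move/(Pup q); congr P; rewrite ?aE; ring.
have r_ge0 : 0 <= r by apply: modz_ge0.
have rc : r < `|c| by apply: ltz_mod.
have detr : r * d - (b - q * d) * c = 1 by rewrite -abcd aE; ring.
have [r0|r0] := eqVneq r 0.
  have bc : - (b - q * d) * c = 1 by rewrite -detr r0; ring.
  have c2 : c * c = 1.
    have := congr1 absz bc; rewrite abszM => /eqP; rewrite muln_eq1 => /andP[_ /eqP c1].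
    by have [->|->] : c = 1 \/ c = -1 by lia.
  have := Pup (- c) _ _ _ _ (Plow c _ _ _ _ (P0 1 (c * (d - 1)) 1 (mulr1 1))).
  have -> : b - q * d = - c by rewrite -[LHS]mulr1 -c2 -[RHS]mul1r -bc; ring.
  rewrite r0; congr P; first by rewrite add0r mulr1 mulNr c2 subrr.
  - by rewrite mulrA c2; ring.
  - by ring.
  - by rewrite mulrA c2; ring.
set r' := (c %% r)%Z; set q' := (c %/ r)%Z.
have cE : c = q' * r + r' by apply: divz_eq.
have r'_ge0 : 0 <= r' by apply: modz_ge0.
have r'r : r' < `|r| by apply: ltz_mod.
have := IHn r (b - q * d) r' (d - q' * (b - q * d)).
move=> h; have /(Plow q') : P r (b - q * d) r' (d - q' * (b - q * d)).
  by apply: h; [lia|rewrite -detr cE; ring].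
by congr P; rewrite ?cE; ring.
Qed.

Inductive levi := Long1 | Long2 | Short.

Definition levi_mx (l : levi) (a b c d : int) : 'M[int]_4 :=
  match l with
  | Long1 => mk4 a 0 b 0  0 1 0 0  c 0 d 0  0 0 0 1
  | Long2 => mk4 1 0 0 0  0 a 0 b  0 0 1 0  0 c 0 d
  | Short => mk4 a b 0 0  c d 0 0  0 0 d (- c)  0 0 (- b) a
  end.

(* The roots of the two opposite unipotent radicals normalized by [l]. *)
Definition radical (l : levi) (r : rootC2) : bool :=
  match l, r with
  | Long1, (E1 | F1) | Long2, (E2 | F2) | Short, (D12 | D21) => false
  | _, _ => true
  end.

Definition in_levi l (g : sp4) : Prop :=
  exists a b c d, a * d - b * c = 1 /\ sp4_mx g = levi_mx l a b c d.

Lemma levi_mx_sp4 l a b c d : a * d - b * c = 1 -> is_sp4 (levi_mx l a b c d).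
Proof.
move=> h; case: l; apply/eqP; rewrite /levi_mx mk4T /J4 !mk4M; congr mk4;
  first [ring | by transitivity (a * d - b * c); first ring
        | by transitivity (- (a * d - b * c)); [ring|rewrite h]].
Qed.

Lemma levi_mxM l a b c d a' b' c' d' :
  levi_mx l a b c d *m levi_mx l a' b' c' d' =
  levi_mx l (a * a' + b * c') (a * b' + b * d') (c * a' + d * c') (c * b' + d * d').
Proof. by case: l; rewrite /levi_mx mk4M; congr mk4; ring. Qed.

Lemma levi_mx1 l : levi_mx l 1 0 0 1 = 1%:M.
Proof. by rewrite mk4_1; case: l; rewrite /= ?oppr0. Qed.

Lemma sp4_mx_leviV l g a b c d : a * d - b * c = 1 ->
  sp4_mx g = levi_mx l a b c d -> sp4_mx g^-1%g = levi_mx l d (- b) (- c) a.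
Proof.
move=> h e; have h' : d * a - (- b) * (- c) = 1 by rewrite -h; ring.
suff -> : (g^-1)%g = sp4_elt (levi_mx_sp4 l h') by [].
apply: mulg1_eq; apply: sp4_mx_inj; rewrite sp4_mxM e sp4_mx1 -(levi_mx1 l).
by rewrite levi_mxM; congr levi_mx; rewrite -?h; ring.
Qed.

Lemma in_leviV l g : in_levi l g -> in_levi l g^-1%g.
Proof.
move=> [a [b [c [d [h e]]]]]; exists d, (- b), (- c), a.
by split; [rewrite -h; ring|apply: sp4_mx_leviV].
Qed.

Definition elementary (A : rootC2 -> bool) (n : int) : sp4 -> Prop :=
  generated (fun x => exists r t, A r /\ x = root_elt r (n * t)).

Lemma elementary_subgroup A n : is_subgroup (elementary A n).
Proof. exact: generated_is_subgroup. Qed.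

Lemma elementary_root (A : rootC2 -> bool) n r t : A r -> elementary A n (root_elt r (n * t)).
Proof. by move=> Ar; apply: mem_generated; exists r, t. Qed.

Lemma elementary_sub (A : rootC2 -> bool) n (H : sp4 -> Prop) : is_subgroup H ->
  (forall r t, A r -> H (root_elt r (n * t))) -> forall x, elementary A n x -> H x.
Proof. by move=> sH AH x; apply=> // _ [r [t [Ar ->]]]; apply: AH. Qed.

Lemma conjg_eq (G : groupType) (x y g : G) : (x * g = g * y -> x ^ g = y)%g.
Proof. by move=> e; rewrite conjgE e mulKg. Qed.

Definition levi_conj (l : levi) (r : rootC2) (u a b c d : int) : seq (rootC2 * int) :=
  match l, r with
  | Long1, E12 => [:: (E12, u * d); (D21, u * c); (E2, u * u * c * d)]
  | Long1, D21 => [:: (D21, u * a); (E12, u * b); (E2, - (u * u * a * b))]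
  | Long1, F12 => [:: (F12, u * a); (D12, - (u * b)); (F2, u * u * a * b)]
  | Long1, D12 => [:: (D12, u * d); (F12, - (u * c)); (F2, - (u * u * c * d))]
  | Long2, E12 => [:: (E12, u * d); (D12, u * c); (E1, u * u * c * d)]
  | Long2, D12 => [:: (D12, u * a); (E12, u * b); (E1, - (u * u * a * b))]
  | Long2, F12 => [:: (F12, u * a); (D21, - (u * b)); (F1, u * u * a * b)]
  | Long2, D21 => [:: (D21, u * d); (F12, - (u * c)); (F1, - (u * u * c * d))]
  | Short, E1 => [:: (E1, u * (d * d)); (E2, u * (c * c)); (E12, - (u * (c * d)))]
  | Short, E2 => [:: (E2, u * (a * a)); (E1, u * (b * b)); (E12, - (u * (a * b)))]
  | Short, E12 => [:: (E12, u * (a * d + b * c)); (E1, - (u * (2 * d * b)));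
                      (E2, - (u * (2 * a * c)))]
  | Short, F1 => [:: (F1, u * (a * a)); (F2, u * (b * b)); (F12, u * (a * b))]
  | Short, F2 => [:: (F2, u * (d * d)); (F1, u * (c * c)); (F12, u * (c * d))]
  | Short, F12 => [:: (F12, u * (a * d + b * c)); (F1, u * (2 * a * c));
                      (F2, u * (2 * b * d))]
  | _, r => [:: (r, u)]
  end.

Definition root_prod (s : seq (rootC2 * int)) : sp4 :=
  foldr (fun p x => root_elt p.1 p.2 * x)%g 1%g s.

Lemma root_prod_conj l r u a b c d g : radical l r -> a * d - b * c = 1 ->
  sp4_mx g = levi_mx l a b c d ->
  (root_elt r u ^ g)%g = root_prod (levi_conj l r u a b c d).
Proof.
move=> lr h e.
apply: conjg_eq; apply: sp4_mx_inj.
by case: l r lr e => [] [] // _ e;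
  rewrite /levi_conj /root_prod /= mulg1 !sp4_mxM e !sp4_mx_root /root_mx /levi_mx !mk4M;
  congr mk4; (ring || by rewrite -[LHS]mulr1 -[X in _ * X = _]h; ring).
Qed.

Lemma elementary_dvd (A : rootC2 -> bool) n r t :
  A r -> (n %| t)%Z -> elementary A n (root_elt r t).
Proof. by move=> Ar /dvdzP[q ->]; rewrite mulrC; apply: elementary_root. Qed.

Lemma dvdz_opp (n t : int) : (n %| - t)%Z = (n %| t)%Z.
Proof. by rewrite !dvdzE abszN. Qed.

Ltac dvdz_factor :=
  rewrite ?dvdz_opp; assumption || exact: dvdzz ||
  (apply: dvdz_mulr; dvdz_factor) || (apply: dvdz_mull; dvdz_factor).

Lemma elementary_levi_conj l n x g : in_levi l g ->
  elementary (radical l) n x -> elementary (radical l) n (x ^ g)%g.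
Proof.
move=> [a [b [c [d [h e]]]]]; have sE := elementary_subgroup (radical l) n.
apply: (elementary_sub (H := fun x => elementary (radical l) n (x ^ g)%g)).
  exact: conj_subgroup.
move=> r t lr; rewrite (root_prod_conj _ lr h e).
have := dvdz_mulr t (dvdzz n); move: (n * t) => u nu.
by case: l r lr sE {e} => [] [] // _ sE; rewrite /root_prod /=;
  repeat (apply: (subgM sE); [apply: elementary_dvd => //; dvdz_factor|]); apply: subg1.
Qed.

Lemma elementary_radical l n x :
  elementary xpredT (2 * n * n) x -> elementary (radical l) n x.
Proof.
have sE := elementary_subgroup (radical l) n.
apply: elementary_sub => // r t _; set u := 2 * n * n * t.
have nu : (n %| u)%Z by dvdz_factor.
have [lr|] := boolP (radical l r); first exact: elementary_dvd.
have nn := dvdzz n; have nt : (n %| 2 * n * t)%Z by dvdz_factor.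
have n2 : (n %| - (n * (2 * n * t) * (2 * n * t)))%Z by dvdz_factor.
have elt r' t' : radical l r' -> (n %| t')%Z -> elementary (radical l) n (root_elt r' t').
  exact: elementary_dvd.
have comm r1 r2 t1 t2 : radical l r1 -> radical l r2 -> (n %| t1)%Z -> (n %| t2)%Z ->
    elementary (radical l) n (root_elt r1 t1 * root_elt r2 t2 *
                              root_elt r1 (- t1) * root_elt r2 (- t2))%g.
  move=> l1 l2 n1 n2'; apply: (subgM sE); first apply: (subgM sE).
  - by apply: (subgM sE); apply: elt.
  - by apply: elt; rewrite ?dvdz_opp.
  - by apply: elt; rewrite ?dvdz_opp.
case: l r @u nu sE elt comm => [] [] // u nu sE elt comm _.
- have -> : root_elt E1 u = (root_elt E12 n * root_elt D12 (- (n * t)) *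
      root_elt E12 (- n) * root_elt D12 (- - (n * t)))%g by rewrite /u; sp4_ring.
  by apply: comm => //; dvdz_factor.
- have -> : root_elt F1 u = (root_elt F12 n * root_elt D21 (n * t) *
      root_elt F12 (- n) * root_elt D21 (- (n * t)))%g by rewrite /u; sp4_ring.
  by apply: comm => //; dvdz_factor.
- have -> : root_elt E2 u = (root_elt E12 n * root_elt D21 (- (n * t)) *
      root_elt E12 (- n) * root_elt D21 (- - (n * t)))%g by rewrite /u; sp4_ring.
  by apply: comm => //; dvdz_factor.
- have -> : root_elt F2 u = (root_elt F12 n * root_elt D12 (n * t) *
      root_elt F12 (- n) * root_elt D12 (- (n * t)))%g by rewrite /u; sp4_ring.
  by apply: comm => //; dvdz_factor.
- have -> : root_elt D12 u = (root_elt E1 n * root_elt F12 (2 * n * t) *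
      root_elt E1 (- n) * root_elt F12 (- (2 * n * t)) *
      root_elt F2 (- (n * (2 * n * t) * (2 * n * t))))%g by rewrite /u; sp4_ring.
  by apply: (subgM sE) => //; [apply: comm|apply: elt].
have -> : root_elt D21 u = (root_elt F1 n * root_elt E12 (- (2 * n * t)) *
      root_elt F1 (- n) * root_elt E12 (- - (2 * n * t)) *
      root_elt E2 (- (n * (2 * n * t) * (2 * n * t))))%g by rewrite /u; sp4_ring.
by apply: (subgM sE) => //; [apply: comm => //; rewrite dvdz_opp|apply: elt].
Qed.

Lemma elementary_conj l n x g : in_levi l g ->
  elementary xpredT (2 * n * n) x -> elementary xpredT n (x ^ g)%g.
Proof.
move=> lg /(elementary_radical (l := l))/(elementary_levi_conj lg).
apply: elementary_sub => [|r t _]; first exact: elementary_subgroup.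
exact: elementary_root.
Qed.

Lemma commutes_subgroup (G : groupType) (E : G -> Prop) (x : G) :
  is_normal E -> is_subgroup (fun y => E [~ x, y]%g).
Proof.
move=> nE; have sE := normal_subgroup nE; split=> [|y z Ey Ez|y Ey].
- by rewrite commg1; apply: subg1.
- have -> : ([~ x, y * z] = [~ x, z] * [~ x, y] ^ z)%g.
    by rewrite !commgEl !conjgE !invgM !mulgA !(mulgK, mulgVK).
  by apply: subgM => //; apply: normalJ.
- have -> : ([~ x, y^-1] = ([~ x, y]^-1) ^ y^-1)%g.
    by rewrite !commgEl !conjgE !invgM !invgK !mulgA !(mulgK, mulgVK, mulgV, mul1g).
  by apply: normalJ => //; apply: subgV.
Qed.

Lemma radical_generates l (H : sp4 -> Prop) : is_subgroup H ->
  (forall r t, radical l r -> H (root_elt r t)) -> forall r t, H (root_elt r t).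
Proof.
move=> sH lH r t; have [/lH//|] := boolP (radical l r).
have comm r1 r2 t1 t2 : radical l r1 -> radical l r2 ->
    H (root_elt r1 t1 * root_elt r2 t2 * root_elt r1 (- t1) * root_elt r2 (- t2))%g.
  by move=> l1 l2; apply: (subgM sH); [apply: (subgM sH); [apply: (subgM sH)|]|]; apply: lH.
case: l r lH comm => [] [] // lH comm _.
- have -> : root_elt E1 t = (root_elt E12 (- t) * (root_elt E2 (- t) * root_elt D12 1 *
      root_elt E2 (- - t) * root_elt D12 (- 1)))%g by sp4_ring.
  by apply: (subgM sH) => //; [apply: lH|apply: comm].
- have -> : root_elt F1 t = (root_elt F12 t * (root_elt F2 (- t) * root_elt D21 1 *
      root_elt F2 (- - t) * root_elt D21 (- 1)))%g by sp4_ring.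
  by apply: (subgM sH) => //; [apply: lH|apply: comm].
- have -> : root_elt E2 t = (root_elt E12 (- t) * (root_elt E1 (- t) * root_elt D21 1 *
      root_elt E1 (- - t) * root_elt D21 (- 1)))%g by sp4_ring.
  by apply: (subgM sH) => //; [apply: lH|apply: comm].
- have -> : root_elt F2 t = (root_elt F12 t * (root_elt F1 (- t) * root_elt D12 1 *
      root_elt F1 (- - t) * root_elt D12 (- 1)))%g by sp4_ring.
  by apply: (subgM sH) => //; [apply: lH|apply: comm].
- have -> : root_elt D12 t = ((root_elt E1 t * root_elt F12 1 *
      root_elt E1 (- t) * root_elt F12 (- 1)) * root_elt F2 (- t))%g by sp4_ring.
  by apply: (subgM sH) => //; [apply: comm|apply: lH].
have -> : root_elt D21 t = ((root_elt F1 (- t) * root_elt E12 1 *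
      root_elt F1 (- - t) * root_elt E12 (- 1)) * root_elt E2 t)%g by sp4_ring.
by apply: (subgM sH) => //; [apply: comm|apply: lH].
Qed.

Lemma levi_generated l (H : sp4 -> Prop) : is_subgroup H ->
  (forall r t, H (root_elt r t)) -> forall g, in_levi l g -> H g.
Proof.
move=> sH rH g [a [b [c [d [h e]]]]].
pose up := match l with Long1 => E1 | Long2 => E2 | Short => D12 end.
pose low := match l with Long1 => F1 | Long2 => F2 | Short => D21 end.
have upE t : sp4_mx (root_elt up t) = levi_mx l 1 t 0 1.
  by rewrite /up; case: (l); rewrite sp4_mx_root /= ?oppr0.
have lowE t : sp4_mx (root_elt low t) = levi_mx l 1 0 t 1.
  by rewrite /low; case: (l); rewrite sp4_mx_root /= ?oppr0.
move: a b c d h g e; apply: sl2_ind => [g e|t a b c d IH g e|t a b c d IH g e].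
- by rewrite (_ : g = 1%g); [apply: subg1|apply: sp4_mx_inj; rewrite e levi_mx1].
- rewrite -[g](mulVKg (root_elt up t)) -root_eltN; apply: (subgM sH) => //.
  by apply: IH; rewrite sp4_mxM upE e levi_mxM; congr levi_mx; ring.
- rewrite -[g](mulVKg (root_elt low t)) -root_eltN; apply: (subgM sH) => //.
  by apply: IH; rewrite sp4_mxM lowE e levi_mxM; congr levi_mx; ring.
Qed.

(** * Bounded generation and finite index *)

Fixpoint levi_prod (k : nat) (g : sp4) : Prop :=
  if k is k'.+1 then
    exists l a b, [/\ in_levi l a, levi_prod k' b & g = (a * b)%g]
  else g = 1%g.

Lemma levi_prod_mull k l a g : in_levi l a -> levi_prod k (a * g)%g -> levi_prod k.+1 g.
Proof.
move=> la pg; exists l, a^-1%g, (a * g)%g.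
by split=> //; [apply: in_leviV|rewrite mulKg].
Qed.

Lemma levi_prodSl k l a g : in_levi l a -> levi_prod k g -> levi_prod k.+1 (a * g)%g.
Proof. by move=> la pg; exists l, a, g. Qed.

Lemma sl2_kill (a c : int) : exists x y z w, x * w - y * z = 1 /\ z * a + w * c = 0.
Proof.
have [g0|g0] := eqVneq (gcdz a c) 0.
  have [a0 c0] : a = 0 /\ c = 0.
    by move/eqP: g0; rewrite gcdz_eq0 => /andP[/eqP -> /eqP ->].
  by exists 1, 0, 0, 1; rewrite a0 c0; split; ring.
have [u [v uv]] := Bezoutz a c.
have /dvdzP[a' aE] := dvdz_gcdl a c; have /dvdzP[c' cE] := dvdz_gcdr a c.
exists u, v, (- c'), a'; split; last by rewrite [in LHS]aE [X in _ + _ * X]cE; ring.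
apply: (mulIf g0); rewrite mul1r -[RHS]uv [in RHS]aE [X in _ = _ + _ * X]cE; ring.
Qed.

Definition levi_elt l a b c d (h : a * d - b * c = 1) : sp4 := sp4_elt (levi_mx_sp4 l h).

Lemma in_levi_elt l a b c d (h : a * d - b * c = 1) : in_levi l (levi_elt l h).
Proof. by exists a, b, c, d. Qed.

Lemma in_levi_E1 t : in_levi Long1 (root_elt E1 t).
Proof. by exists 1, t, 0, 1; split; [ring|]. Qed.

Lemma in_levi_D12 t : in_levi Short (root_elt D12 t).
Proof. by exists 1, t, 0, 1; split; [ring|rewrite sp4_mx_root /= oppr0]. Qed.

Lemma levi_prod_unipotent g p q s t u :
  sp4_mx g = mk4 1 p s q  0 1 t 0  0 0 1 0  0 0 u 1 -> levi_prod 5 g.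
Proof.
move=> e; have [[_ _ _] [up _] tq] := sp4_rel e.
have h1 : 0 * 0 - 1 * -1 = 1 :> int by [].
pose w := levi_elt Long2 h1.
have -> : g = (root_elt D12 p * (w * (root_elt D12 (- q) * (w^-1 *
                (root_elt E1 (s - p * q) * 1)))))%g.
  apply: sp4_mx_inj; rewrite e !sp4_mxM !sp4_mx_root sp4_mx1.
  rewrite (@sp4_mx_leviV Long2 w 0 1 (-1) 0 h1 erefl) /w mk4_1 /= !mk4M.
  have -> : u = - p by lia.
  have -> : t = q by lia.
  by congr mk4; ring.
apply: (levi_prodSl (in_levi_D12 _)); apply: (levi_prodSl (in_levi_elt Long2 h1)).
apply: (levi_prodSl (in_levi_D12 _)).
apply: (levi_prodSl (in_leviV (in_levi_elt Long2 h1))).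
by apply: (levi_prodSl (in_levi_E1 _)).
Qed.

Lemma levi_prod6 g a01 a02 a03 a11 a12 a13 a21 a22 a23 a31 a32 a33 :
  sp4_mx g = mk4 1 a01 a02 a03  0 a11 a12 a13  0 a21 a22 a23  0 a31 a32 a33 ->
  levi_prod 6 g.
Proof.
move=> e; have [[r01 r02 r03] [_ r13] _] := sp4_rel e.
have z21 : a21 = 0 by lia.
have z22 : a22 = 1 by lia.
have z23 : a23 = 0 by lia.
have h : a33 * a11 - (- a13) * (- a31) = 1 by rewrite -r13 z21 z23; ring.
apply: (levi_prod_mull (in_levi_elt Long2 h)).
have d : a11 * a33 - a31 * a13 = 1 by rewrite -h; ring.
apply: (@levi_prod_unipotent _ a01 a03 a02 (a33 * a12 - a13 * a32) (- a31 * a12 + a11 * a32)).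
rewrite sp4_mxM e /= mk4M z21 z22 z23; congr mk4;
  first [ring | by transitivity (a11 * a33 - a31 * a13); first ring].
Qed.

Lemma levi_prod7 g a00 a01 a02 a03 a11 a12 a13 a21 a22 a23 a31 a32 a33 :
  sp4_mx g = mk4 a00 a01 a02 a03  0 a11 a12 a13  0 a21 a22 a23  0 a31 a32 a33 ->
  levi_prod 7 g.
Proof.
move=> e; have [[_ r02 _] _ _] := sp4_rel e.
have a2 : a00 * a22 = 1 by lia.
have aa : a00 * a00 = 1.
  have := congr1 absz a2; rewrite abszM => /eqP; rewrite muln_eq1 => /andP[/eqP a1 _].
  by have [->|->] : a00 = 1 \/ a00 = -1 by lia.
have h : a00 * a00 - 0 * 0 = 1 by rewrite aa; ring.
apply: (levi_prod_mull (in_levi_elt Long1 h)).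
apply: (@levi_prod6 _ (a00 * a01) (a00 * a02) (a00 * a03) a11 a12 a13 
         (a00 * a21) (a00 * a22) (a00 * a23) a31 a32 a33).
by rewrite sp4_mxM e /= mk4M; congr mk4; first [ring | by rewrite aa; ring].
Qed.

Lemma levi_prod8 g a00 a01 a02 a03 a10 a11 a12 a13 a21 a22 a23 a31 a32 a33 :
  sp4_mx g = mk4 a00 a01 a02 a03  a10 a11 a12 a13  0 a21 a22 a23  0 a31 a32 a33 ->
  levi_prod 8 g.
Proof.
move=> e; have [x [y [z [w [h hz]]]]] := sl2_kill a00 a10.
apply: (levi_prod_mull (in_levi_elt Short h)).
set k := (_ * _)%g; have := sp4_mxM (levi_elt Short h) g; rewrite e /= mk4M.
rewrite !(mulr0, mul0r, addr0, add0r) hz => ek.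
exact: levi_prod7 ek.
Qed.

Lemma levi_prod9 g a00 a01 a02 a03 a10 a11 a12 a13 a21 a22 a23 a30 a31 a32 a33 :
  sp4_mx g = mk4 a00 a01 a02 a03  a10 a11 a12 a13  0 a21 a22 a23  a30 a31 a32 a33 ->
  levi_prod 9 g.
Proof.
move=> e; have [x [y [z [w [h hz]]]]] := sl2_kill a10 a30.
apply: (levi_prod_mull (in_levi_elt Long2 h)).
have := sp4_mxM (levi_elt Long2 h) g; rewrite e /= mk4M.
rewrite !(mulr0, mul0r, addr0, add0r) hz => ek.
exact: levi_prod8 ek.
Qed.

Lemma levi_prod10 g : levi_prod 10 g.
Proof.
have [a00 [a01 [a02 [a03 [a10 [a11 [a12 [a13 [a20 [a21 [a22 [a23
  [a30 [a31 [a32 [a33 e]]]]]]]]]]]]]]]] := mk4_ex (sp4_mx g).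
have [x [y [z [w [h hz]]]]] := sl2_kill a00 a20.
apply: (levi_prod_mull (in_levi_elt Long1 h)).
have := sp4_mxM (levi_elt Long1 h) g; rewrite e /= mk4M.
rewrite !(mulr0, mul0r, addr0, add0r) hz => ek.
exact: levi_prod9 ek.
Qed.

Lemma root_generates (H : sp4 -> Prop) : is_subgroup H ->
  (forall r, H (root_elt r 1)) -> forall g, H g.
Proof.
move=> sH rH g; have : levi_prod 10 g by apply: levi_prod10.
elim: (10)%N g => [g -> |k IHk _ [l [a [b [la /IHk Hb ->]]]]]; first exact: subg1.
apply: (subgM sH) => //; apply: levi_generated la => // r t.
by rewrite -[t]mul1r; apply: subg_root.
Qed.

Lemma elementary_conj_all n : exists m, [/\ m = 0 -> n = 0 &
  forall x g, elementary xpredT m x -> elementary xpredT n (x ^ g)%g].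
Proof.
suff [m [m0 mP]] : exists m, (m = 0 -> n = 0) /\ forall x g, levi_prod 10 g ->
    elementary xpredT m x -> elementary xpredT n (x ^ g)%g.
  by exists m; split=> // x g; apply: mP; apply: levi_prod10.
elim: (10)%N => [|k [m [m0 mP]]].
  by exists n; split=> // x g ->; rewrite conjg1.
exists (2 * m * m); split=> [/eqP|x _ [l [a [b [la kb ->]]]] mx].
  by rewrite !mulf_eq0 /= orbb => /eqP/m0.
by rewrite conjgM; apply: mP => //; apply: elementary_conj la mx.
Qed.

Definition residue (m x : int) : 'I_`|m|.-1.+1 := inord `|(x %% m)%Z|.

Lemma residueP m x y : m != 0 -> residue m x = residue m y -> (m %| x - y)%Z.
Proof.
move=> m0 /(congr1 val); have lt z : (`|(z %% m)%Z| < `|m|.-1.+1)%N.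
  rewrite prednK ?absz_gt0 // -ltz_nat gez0_abs ?modz_ge0 //.
  exact: ltz_mod.
rewrite /residue /= !inordK // => e; rewrite -eqz_mod_dvd; apply/eqP.
by rewrite -[LHS]gez0_abs ?modz_ge0 // e gez0_abs ?modz_ge0.
Qed.

Definition mx_residue (m : int) (M : 'M[int]_4) :=
  [ffun ij : 'I_4 * 'I_4 => residue m (M ij.1 ij.2)].

Lemma mx_residueP m M N i j : m != 0 -> mx_residue m M = mx_residue m N ->
  (m %| M i j - N i j)%Z.
Proof. by move=> m0 /ffunP/(_ (i, j)); rewrite !ffunE; apply: residueP. Qed.

Section CentralFiniteIndex.
Variables (E : sp4 -> Prop) (m : int).
Hypotheses (nE : is_normal E) (m_neq0 : m != 0) (mE : forall r, E (root_elt r m)).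

Let sE : is_subgroup E := normal_subgroup nE.

Let E_dvd r t : (m %| t)%Z -> E (root_elt r t).
Proof. by move=> /dvdzP[q ->]; rewrite mulrC; apply: subg_root. Qed.

(* It suffices to commute modulo [E] with the two radicals, since they generate. *)
Lemma congruence_central l g a b c d : a * d - b * c = 1 ->
  (m %| a - 1)%Z -> (m %| b)%Z -> (m %| c)%Z -> (m %| d - 1)%Z ->
  sp4_mx g = levi_mx l a b c d -> central_mod E g.
Proof.
move=> h ma mb mc md e y; have sC := commutes_subgroup g nE.
apply: (root_generates sC) => r; move: r (1); apply: (radical_generates (l := l) sC).
move=> r u lr; rewrite -invgR; apply: (subgV sE).
rewrite commgEl -root_eltN (root_prod_conj _ lr h e).
have head k : (m %| k - 1)%Z -> (m %| - u + u * k)%Z.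
  by move=> mk; rewrite addrC -[X in _ - X]mulr1 -mulrBr dvdz_mull.
have maa : (m %| a * a - 1)%Z.
  by rewrite (_ : a * a - 1 = (a - 1) * (a + 1)) ?dvdz_mulr //; ring.
have mdd : (m %| d * d - 1)%Z.
  by rewrite (_ : d * d - 1 = (d - 1) * (d + 1)) ?dvdz_mulr //; ring.
have mad : (m %| a * d + b * c - 1)%Z.
  have -> : a * d + b * c - 1 = 2 * b * c + (a * d - b * c - 1) by ring.
  by rewrite h subrr addr0 dvdz_mull.
have m0 : (m %| - u + u)%Z by rewrite addNr.
by case: l r lr {e sC} => [] [] // _; rewrite /root_prod /= mulgA root_eltD;
  (apply: (subgM sE); [by apply: E_dvd; first [exact: m0 | exact: head]|]);
  repeat (apply: (subgM sE); [apply: E_dvd; dvdz_factor|]); apply: subg1.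
Qed.

Lemma levi_finite_cover l : finite_cover (in_levi l) (central_mod E).
Proof.
apply: (finite_cover_color (c := fun g => mx_residue m (sp4_mx g))) => g g' lg lg' cgg'.
have gg' i j : (m %| sp4_mx g i j - sp4_mx g' i j)%Z.
  exact: mx_residueP.
have [a [b [c0 [d [h e]]]]] := lg; have [a' [b' [c' [d' [h' e']]]]] := lg'.
pose o k (hk : (k < 4)%N) := Ordinal hk.
have [ma mb mc md] : [/\ (m %| a - a')%Z, (m %| b - b')%Z, (m %| c0 - c')%Z
    & (m %| d - d')%Z].
  case: (l) e e' => e e'.
  - have := (gg' (o 0%N isT) (o 0%N isT), gg' (o 0%N isT) (o 2%N isT),
             gg' (o 2%N isT) (o 0%N isT), gg' (o 2%N isT) (o 2%N isT)).
    by rewrite e e' !mxE /= => -[[[]]].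
  - have := (gg' (o 1%N isT) (o 1%N isT), gg' (o 1%N isT) (o 3%N isT),
             gg' (o 3%N isT) (o 1%N isT), gg' (o 3%N isT) (o 3%N isT)).
    by rewrite e e' !mxE /= => -[[[]]].
  - have := (gg' (o 0%N isT) (o 0%N isT), gg' (o 0%N isT) (o 1%N isT),
             gg' (o 1%N isT) (o 0%N isT), gg' (o 1%N isT) (o 1%N isT)).
    by rewrite e e' !mxE /= => -[[[]]].
have := sp4_mx_leviV h e => eV.
have eM : sp4_mx (g^-1 * g')%g = levi_mx l (d * a' - b * c') (d * b' - b * d')
            (- c0 * a' + a * c') (- c0 * b' + a * d').
  by rewrite sp4_mxM eV e' levi_mxM; congr levi_mx; ring.
have dvdD x y : (m %| x)%Z -> (m %| y)%Z -> (m %| x + y)%Z by apply: rpredD.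
apply: (congruence_central _ _ _ _ _ eM).
- rewrite (_ : _ - _ = (a * d - b * c0) * (a' * d' - b' * c')); last by ring.
  by rewrite h h'.
- rewrite (_ : _ - 1 = b * (c0 - c') + - (d * (a - a'))); last by rewrite -h; ring.
  by apply: dvdD; dvdz_factor.
- rewrite (_ : _ - _ = b * (d - d') + - (d * (b - b'))); last by ring.
  by apply: dvdD; dvdz_factor.
- rewrite (_ : _ + _ = c0 * (a - a') + - (a * (c0 - c'))); last by ring.
  by apply: dvdD; dvdz_factor.
- rewrite (_ : _ - 1 = c0 * (b - b') + - (a * (d - d'))); last by rewrite -h; ring.
  by apply: dvdD; dvdz_factor.
Qed.

Lemma sp4_finite_cover_central : finite_cover (fun=> True) (central_mod E).
Proof.
have nZ := central_mod_normal nE.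
have any_levi : finite_cover (fun g => exists l, in_levi l g) (central_mod E).
  have [F1 P1] := levi_finite_cover Long1; have [F2 P2] := levi_finite_cover Long2.
  have [F3 P3] := levi_finite_cover Short.
  exists (F1 ++ F2 ++ F3) => g [[] lg].
  - by have [f Ff Zf] := P1 g lg; exists f; rewrite // !mem_cat Ff.
  - by have [f Ff Zf] := P2 g lg; exists f; rewrite // !mem_cat Ff orbT.
  - by have [f Ff Zf] := P3 g lg; exists f; rewrite // !mem_cat Ff !orbT.
suff : finite_cover (levi_prod 10) (central_mod E).
  by apply: finite_cover_sub => // x _; apply: levi_prod10.
elim: (10)%N => [|k IHk].
  exists [:: 1%g] => g ->; exists 1%g; first exact: mem_head.
  by rewrite mulg1 invg1; apply: (subg1 (normal_subgroup nZ)).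
apply: finite_cover_sub (finite_cover_mul nZ any_levi IHk) => // g.
by move=> [l [a [b [la kb ->]]]]; exists a, b; split=> //; exists l.
Qed.

End CentralFiniteIndex.

Theorem sp4_finite_index (H : sp4 -> Prop) (n : int) : is_subgroup H -> n != 0 ->
  (forall r, H (root_elt r n)) -> finite_cover (fun=> True) H.
Proof.
move=> sH n0 nH; have [m [m0 mP]] := elementary_conj_all n.
pose E := normal_closure (elementary xpredT m).
have nE : is_normal E by apply: normal_closure_normal.
have EH x : E x -> H x.
  apply=> // _ [y [g [my ->]]]; apply: (elementary_sub (n := n) sH _ (mP _ _ my)).
  by move=> r t _; apply: subg_root.
have mE r : E (root_elt r m).
  by apply: sub_normal_closure; rewrite -[X in root_elt _ X]mulr1; apply: elementary_root.
have m_neq0 : m != 0 by apply: contraNneq n0 => /m0 ->.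
apply: (finite_cover_sub (fun _ => id) EH).
apply: (@central_finite_index_finite_index _ _ nE
  [seq root_elt r 1 | r <- [:: E1; E2; E12; D12; F1; F2; F12; D21]] `|m|%N).
- by rewrite absz_gt0.
- move=> K sK rK; apply: root_generates => // r; apply: rK.
  have : List.In r [:: E1; E2; E12; D12; F1; F2; F12; D21] by case: r => /=; tauto.
  elim: [:: _, _ & _] => //= r' s IHs [->|/IHs rs]; first exact: mem_head.
  by rewrite inE rs orbT.
- move=> g gs; have {gs}[r ->] : exists r, g = root_elt r 1.
    by elim: [:: _, _ & _] gs => //= r s IHs; rewrite inE => /orP[/eqP ->|/IHs//]; exists r.
  rewrite root_eltX natz abszE normrEsg mulrC.
  exact: subg_root (normal_subgroup nE) (mE r).
- exact: sp4_finite_cover_central mE.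
Qed.

(** * Integral forms and commensurability *)

Local Open Scope classical_set_scope.
Local Open Scope ring_scope.

Section IntegralForms.
Implicit Types (Om M N : 'M[int]_4) (H : set 'M[int]_4).

Lemma SL4Z_unit M : SL4Z M -> M \in unitmx.
Proof. by rewrite /SL4Z /= unitmxE => ->; rewrite unitr1. Qed.

Lemma bform_delta Om i j : bform Om (delta_mx i 0) (delta_mx j 0) = Om i j.
Proof. by rewrite /bform trmx_delta -rowE -colE !mxE. Qed.

Lemma preservesE Om M : preserves Om M <-> M^T *m Om *m M = Om.
Proof.
have e v w : bform Om (M *m v) (M *m w) = bform (M^T *m Om *m M) v w.
  by rewrite /bform trmx_mul !mulmxA.
split=> [h|h v w]; last by rewrite e h.
by apply/matrixP => i j; rewrite -bform_delta -e h bform_delta.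
Qed.

Lemma alternating_entry Om i j : alternating Om -> Om j i = - Om i j.
Proof.
move=> aOm; have d k : Om k k = 0 by rewrite -bform_delta aOm.
have := aOm (delta_mx i 0 + delta_mx j 0).
rewrite /bform [(_ + _)^T]linearD /= !mulmxDl !mulmxDr mxE.
rewrite [X in X + _ = _]mxE [X in _ + X = _]mxE.
have b k l : ((delta_mx k 0)^T *m Om *m delta_mx l 0) 0 0 = Om k l := bform_delta Om k l.
by rewrite !b !d add0r addr0 addrC => /eqP; rewrite addr_eq0 => /eqP.
Qed.

Lemma alternating_antisym Om : Om^T = - Om -> alternating Om.
Proof.
move=> aOm v; rewrite /bform; set x := (v^T *m Om *m v).
have : x^T = - x by rewrite /x !trmx_mul trmxK aOm mulNmx mulmxN mulmxA.
by move/matrixP/(_ 0 0); rewrite !mxE; lia.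
Qed.

Lemma nondegenerate_det Om : \det Om != 0 -> nondegenerate_over_Q Om.
Proof.
move=> dOm v hv; pose Q : 'M[rat]_4 := map_mx intr Om.
have uQ : Q \in unitmx by rewrite unitmxE det_map_mx unitfE intr_eq0.
have e : v^T *m Q = 0.
  apply/matrixP => i j; have := hv (delta_mx j 0).
  by rewrite /bform -colE mxE => h; rewrite (ord1 i) [RHS]mxE.
by apply: trmx_inj; rewrite -[v^T](mulmxK uQ) e mul0mx trmx0.
Qed.

Lemma nondegenerate_neq0 Om : nondegenerate_over_Q Om -> Om != 0.
Proof.
move=> nOm; apply/eqP => Om0.
have /matrixP/(_ 0 0) : delta_mx 0 0 = 0 :> 'cV[rat]_4.
  by apply: nOm => w; rewrite Om0 map_mx0 /bform mulmx0 mul0mx mxE.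
by rewrite !mxE.
Qed.

Lemma Sp4Z_scale Om Om' (a b : int) : a != 0 -> b != 0 -> a *: Om = b *: Om' ->
  Sp4Z Om = Sp4Z Om'.
Proof.
have scaleI (k : int) X Y : k != 0 -> k *: X = k *: Y -> X = Y :> 'M[int]_4.
  move=> k0 /matrixP e; apply/matrixP => i j; have := e i j; rewrite !mxE.
  exact: mulfI.
move=> a0 b0 e; apply/seteqP; split=> M [SM /preservesE MOm]; split=> //; apply/preservesE.
  by apply: (scaleI b) => //; rewrite scalemxAl scalemxAr -e -scalemxAr -scalemxAl MOm.
by apply: (scaleI a) => //; rewrite scalemxAl scalemxAr e -scalemxAr -scalemxAl MOm.
Qed.

Lemma subgroup_SL4Z_Sp4Z Om : subgroup_SL4Z (Sp4Z Om).
Proof.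
split=> [M []//||M N [SM /preservesE pM] [SN /preservesE pN]|M [SM /preservesE pM]].
- by split; [rewrite /SL4Z /= det1|apply/preservesE; rewrite trmx1 mul1mx mulmx1].
- split; first by rewrite /SL4Z /= det_mulmx SM SN mulr1.
  apply/preservesE; rewrite trmx_mul !mulmxA -(mulmxA _ M^T) -(mulmxA _ _ M).
  by rewrite pM.
split; first by rewrite /SL4Z /= det_inv SM invr1.
have uM := SL4Z_unit SM.
apply/preservesE; rewrite -{1}pM !mulmxA -trmx_mul mulmxV // trmx1 mul1mx -mulmxA.
by rewrite mulmxV // mulmx1.
Qed.

Lemma finite_image_labels (T L : choiceType) (U : Type) (h : T -> U) (A : set T)
    (s : seq L) (R : T -> L -> Prop) :
  (forall x, A x -> exists2 l, l \in s & R x l) ->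
  (forall l x y, A x -> A y -> R x l -> R y l -> h x = h y) ->
  finite_set (h @` A).
Proof.
move=> As Rh.
have [[x0 Ax0]|A0] := pselect (exists x, A x); last first.
  suff -> : h @` A = set0 by [].
  by rewrite -subset0 => y [x Ax _]; apply: A0; exists x.
pose c l := h (xget x0 [set x | A x /\ R x l]).
apply: (@sub_finite_set _ _ (c @` [set` s])); last exact/finite_image/finite_seq.
move=> _ [x Ax <-]; have [l ls Rl] := As x Ax; exists l => //; rewrite /c.
have [Ay Ry] : A (xget x0 [set x | A x /\ R x l]) /\ R (xget x0 [set x | A x /\ R x l]) l.
  by apply: (@xgetPex _ x0 [set x | A x /\ R x l]); exists x.
exact: (Rh l).
Qed.

Lemma left_coset_eq H M N : subgroup_SL4Z H -> SL4Z M -> H (invmx M *m N) ->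
  left_coset M H = left_coset N H.
Proof.
move=> [HS H1 HM HV] SM Hx; have uM := SL4Z_unit SM.
have NE : N = M *m (invmx M *m N) by rewrite mulmxA mulmxV // mul1mx.
have uX := SL4Z_unit (HS _ Hx).
apply/seteqP; split=> _ [X HX <-].
  exists (invmx (invmx M *m N) *m X); first by apply: HM => //; apply: HV.
  rewrite {1}NE -!mulmxA (mulmxA (invmx M)) [_ *m (invmx (_ *m _) *m X)]mulmxA.
  by rewrite mulmxV ?mul1mx.
by exists (invmx M *m N *m X); [apply: HM|rewrite !mulmxA mulmxV // mul1mx].
Qed.

End IntegralForms.

Lemma scalemx_inj (k : int) (m n : nat) (X Y : 'M[int]_(m, n)) :
  k != 0 -> k *: X = k *: Y -> X = Y.
Proof.
move=> k0 /matrixP e; apply/matrixP => i j; have := e i j; rewrite !mxE.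
exact: mulfI.
Qed.

Lemma det_J4 : \det J4 != 0.
Proof.
apply/eqP => d0; have := congr1 determinant mul_J4_tr.
by rewrite det_mulmx d0 mul0r det1 => /eqP; rewrite eq_sym oner_eq0.
Qed.

Definition conj_mem (Gam : set 'M[int]_4) (P : 'M[int]_4) (X : sp4) : Prop :=
  exists2 M, Gam M & M *m P = P *m sp4_mx X.

Lemma conj_mem_subgroup Gam P : subgroup_SL4Z Gam -> is_subgroup (conj_mem Gam P).
Proof.
move=> [GS G1 GM GV]; split=> [|X Y [M GX MX] [N GY NY]|X [M GX MX]].
- by exists 1%:M; rewrite // sp4_mx1 mul1mx mulmx1.
- by exists (M *m N); [apply: GM|rewrite -mulmxA NY !mulmxA MX -mulmxA -sp4_mxM].
exists (invmx M); first exact: GV.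
have uM := SL4Z_unit (GS _ GX).
have XV : sp4_mx X *m sp4_mx X^-1%g = 1%:M by rewrite -sp4_mxM mulgV.
have: invmx M *m (M *m P) *m sp4_mx X^-1%g = P *m sp4_mx X^-1%g.
  by rewrite (mulmxA (invmx M)) mulVmx // mul1mx.
by rewrite MX -!mulmxA XV mulmx1.
Qed.

Section Commensurable.
Variables (Gam : set 'M[int]_4) (Om P : 'M[int]_4) (c : int).
Hypotheses (sG : subgroup_SL4Z Gam) (GOm : Gam `<=` Sp4Z Om).
Hypotheses (POm : P^T *m Om *m P = c *: J4) (c0 : c != 0).

Lemma symplectic_basis_det : \det P != 0 /\ \det Om != 0.
Proof.
have := congr1 determinant POm; rewrite !det_mulmx det_tr detZ => e.
have : \det P * \det Om * \det P != 0 by rewrite e mulf_neq0 ?det_J4 ?expf_neq0.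
by rewrite !mulf_eq0 !negb_or => /andP[/andP[]].
Qed.

Let D := \det P.
Let D0 : D != 0. Proof. by have [] := symplectic_basis_det. Qed.

Let PIr X Y : X *m P = Y *m P -> X = Y :> 'M_4.
Proof.
move=> e; apply: (scalemx_inj D0).
by rewrite -!mul_mx_scalar -mul_mx_adj !mulmxA e.
Qed.

Let conjP := conj_mem Gam P.
Let conjP_subgroup : is_subgroup conjP := conj_mem_subgroup P sG.

Let congruent_conj M N : Sp4Z Om M -> Sp4Z Om N -> mx_residue D M = mx_residue D N ->
  exists X : sp4, invmx M *m N *m P = P *m sp4_mx X.
Proof.
move=> SM SN /esym cMN; have [_ _ SpM SpV] := subgroup_SL4Z_Sp4Z Om.
pose R := \matrix_(i, j) ((N i j - M i j) %/ D)%Z.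
have NE : N = M + D *: R.
  apply/matrixP => i j; rewrite !mxE.
  have /dvdzP[q e] := mx_residueP i j D0 cMN.
  by rewrite e mulzK // mulrC -e addrC subrK.
have uM := SL4Z_unit SM.1.
pose X := 1%:M + \adj P *m (invmx M *m R *m P).
have PX : P *m X = invmx M *m N *m P.
  rewrite NE mulmxDr mulmx1 !mulmxA mul_mx_adj mulmxDr mulVmx // mulmxDl mul1mx.
  by rewrite -scalemxAr mul_scalar_mx !scalemxAl.
suff sX : is_sp4 X by exists (sp4_elt sX).
have /preservesE := (SpM _ _ (SpV _ SM) SN).2; move: PX; move: (invmx M *m N) => Q PX sQ.
apply/eqP; apply: (scalemx_inj c0); rewrite scalemxAl scalemxAr -POm.
rewrite !mulmxA -trmx_mul PX -(mulmxA _ P X) PX trmx_mul !mulmxA.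
by rewrite -(mulmxA P^T Q^T) -(mulmxA P^T (Q^T *m Om)) sQ.
Qed.

Theorem finite_index_of_root_elements (n : int) : n != 0 ->
  (forall r, exists2 M, Gam M & M *m P = P *m root_mx r n) ->
  finite_index Gam (Sp4Z Om).
Proof.
move=> n0 rP; split=> //; have [GS G1 GM GV] := sG.
have [SpS _ SpM SpV] := subgroup_SL4Z_Sp4Z Om.
have [F FP] := sp4_finite_index conjP_subgroup n0 rP.
pose rep t := xget 1%:M [set M | Sp4Z Om M /\ mx_residue D M = t].
pose R M (l : {ffun 'I_4 * 'I_4 -> 'I_`|D|.-1.+1} * sp4) :=
  mx_residue D M = l.1 /\ exists X : sp4,
    invmx (rep l.1) *m M *m P = P *m sp4_mx X /\ conjP (l.2^-1 * X)%g.
have repP M : Sp4Z Om M -> Sp4Z Om (rep (mx_residue D M)) /\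
    mx_residue D (rep (mx_residue D M)) = mx_residue D M.
  move=> SM; apply: (@xgetPex _ 1%:M [set N | Sp4Z Om N /\ mx_residue D N = mx_residue D M]).
  by exists M.
apply: (@finite_image_labels _ _ _ _ _
  [seq (t, f) | t <- enum {ffun 'I_4 * 'I_4 -> 'I_`|D|.-1.+1}, f <- F] R).
  move=> M SM; have [Sr cr] := repP M SM.
  have [X eX] := congruent_conj Sr SM cr; have [f Ff Hf] := FP X I.
  exists (mx_residue D M, f); last by split=> //; exists X.
  by apply/allpairsP; exists (mx_residue D M, f); rewrite mem_enum.
move=> [t f] M N SM SN [/= cM [X [eX HX]]] [cN [Y [eY HY]]].
apply: left_coset_eq => //; first exact: SpS.
have [Sr _] := repP M SM; rewrite cM in Sr.
have ur := SL4Z_unit Sr.1; have uM := SL4Z_unit SM.1.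
have [K GK KP] : conjP (X^-1 * Y)%g.
  have := subgM conjP_subgroup (subgV conjP_subgroup HX) HY.
  by rewrite invgM invgK mulgA mulgK.
suff -> : invmx M *m N = K by [].
apply: PIr; rewrite KP sp4_mxM.
have MP : M *m P = rep t *m P *m sp4_mx X.
  by rewrite -mulmxA -eX !mulmxA mulmxV // mul1mx.
have NP : N *m P = rep t *m P *m sp4_mx Y.
  by rewrite -mulmxA -eY !mulmxA mulmxV // mul1mx.
rewrite -mulmxA NP.
have -> : rep t *m P = M *m P *m sp4_mx X^-1%g.
  by rewrite MP -mulmxA -sp4_mxM mulgV sp4_mx1 mulmx1.
by rewrite !mulmxA mulVmx // mul1mx.
Qed.

End Commensurable.

Definition cvec (a b c d : int) : 'cV[int]_4 := \col_i nth 0 [:: a; b; c; d] i.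

Lemma mul_mk4_cvec a00 a01 a02 a03 a10 a11 a12 a13 a20 a21 a22 a23 a30 a31 a32 a33
    x0 x1 x2 x3 :
  mk4 a00 a01 a02 a03 a10 a11 a12 a13 a20 a21 a22 a23 a30 a31 a32 a33 *m
  cvec x0 x1 x2 x3 =
  cvec (a00 * x0 + a01 * x1 + a02 * x2 + a03 * x3)
       (a10 * x0 + a11 * x1 + a12 * x2 + a13 * x3)
       (a20 * x0 + a21 * x1 + a22 * x2 + a23 * x3)
       (a30 * x0 + a31 * x1 + a32 * x2 + a33 * x3).
Proof.
by apply/matrixP => -[[|[|[|[|i]]]] hi] j //;
  rewrite !mxE !big_ord_recr big_ord0 /= !mxE /= add0r.
Qed.

Lemma mul_cvec_tr x0 x1 x2 x3 y0 y1 y2 y3 :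
  cvec x0 x1 x2 x3 *m (cvec y0 y1 y2 y3)^T =
  mk4 (x0 * y0) (x0 * y1) (x0 * y2) (x0 * y3) (x1 * y0) (x1 * y1) (x1 * y2) (x1 * y3)
      (x2 * y0) (x2 * y1) (x2 * y2) (x2 * y3) (x3 * y0) (x3 * y1) (x3 * y2) (x3 * y3).
Proof.
by apply/matrixP => -[[|[|[|[|i]]]] hi] [[|[|[|[|j]]]] hj] //;
  rewrite !mxE big_ord1 !mxE.
Qed.

Lemma mk4D a00 a01 a02 a03 a10 a11 a12 a13 a20 a21 a22 a23 a30 a31 a32 a33
           b00 b01 b02 b03 b10 b11 b12 b13 b20 b21 b22 b23 b30 b31 b32 b33 :
  mk4 a00 a01 a02 a03 a10 a11 a12 a13 a20 a21 a22 a23 a30 a31 a32 a33 +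
  mk4 b00 b01 b02 b03 b10 b11 b12 b13 b20 b21 b22 b23 b30 b31 b32 b33 =
  mk4 (a00 + b00) (a01 + b01) (a02 + b02) (a03 + b03)
      (a10 + b10) (a11 + b11) (a12 + b12) (a13 + b13)
      (a20 + b20) (a21 + b21) (a22 + b22) (a23 + b23)
      (a30 + b30) (a31 + b31) (a32 + b32) (a33 + b33).
Proof.
by apply/matrixP => -[[|[|[|[|i]]]] hi] [[|[|[|[|j]]]] hj] //; rewrite !mxE.
Qed.

Lemma mk4Z k a00 a01 a02 a03 a10 a11 a12 a13 a20 a21 a22 a23 a30 a31 a32 a33 :
  k *: mk4 a00 a01 a02 a03 a10 a11 a12 a13 a20 a21 a22 a23 a30 a31 a32 a33 =
  mk4 (k * a00) (k * a01) (k * a02) (k * a03) (k * a10) (k * a11) (k * a12) (k * a13)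
      (k * a20) (k * a21) (k * a22) (k * a23) (k * a30) (k * a31) (k * a32) (k * a33).
Proof.
by apply/matrixP => -[[|[|[|[|i]]]] hi] [[|[|[|[|j]]]] hj] //; rewrite !mxE.
Qed.

Definition transvection (Om : 'M[int]_4) (v : 'cV[int]_4) : 'M[int]_4 :=
  1%:M + v *m v^T *m Om.

Section Transvections.
Variables (Gam : set 'M[int]_4) (Om : 'M[int]_4).
Hypotheses (sG : subgroup_SL4Z Gam) (GOm : Gam `<=` Sp4Z Om).
Hypothesis aOm : alternating Om.

Lemma transvection_conj M v : Gam M -> Gam (transvection Om v) ->
  Gam (transvection Om (M *m v)).
Proof.
move=> GM Gv; have [GS _ GMul GV] := sG; have [SM /preservesE pM] := GOm GM.
have uM := SL4Z_unit SM.
suff -> : transvection Om (M *m v) = M *m transvection Om v *m invmx M.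
  exact: GMul (GMul _ _ GM Gv) (GV _ GM).
rewrite /transvection mulmxDr mulmxDl mulmx1 mulmxV //; congr (_ + _).
have e : M^T *m Om = Om *m invmx M.
  by rewrite -[in RHS]pM -!mulmxA mulmxV // mulmx1.
by rewrite trmx_mul -!mulmxA e.
Qed.

Lemma transvection_scale k v : Gam (transvection Om v) -> Gam (transvection Om (k *: v)).
Proof.
move=> Gv; have [GS G1 GM GV] := sG; pose X := v *m v^T *m Om.
have vv : v^T *m Om *m v = 0.
  by apply/matrixP => i j; rewrite (ord1 i) (ord1 j) [RHS]mxE; apply: aOm.
have XX : X *m X = 0.
  by rewrite /X -!mulmxA (mulmxA Om) (mulmxA v^T (Om *m v)) (mulmxA v^T Om) vv mul0mx mulmx0.
pose T (j : int) := 1%:M + j *: X.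
have TD i j : T i *m T j = T (i + j).
  rewrite /T mulmxDl !mulmxDr !mul1mx mulmx1 -scalemxAl -scalemxAr XX !scaler0 addr0.
  by rewrite -addrA -scalerDl (addrC j).
have GT1 : Gam (T 1) by rewrite /T scale1r.
have GTm : Gam (T (-1)).
  rewrite (_ : T (-1) = invmx (T 1)); first exact: GV.
  have u1 := SL4Z_unit (GS _ GT1).
  by rewrite -[LHS](mulmxK u1) TD addNr /T scale0r addr0 mul1mx.
have GT j : Gam (T j).
  elim/int_rec: j => [|j Gj|j Gj]; first by rewrite /T scale0r addr0.
    by rewrite intS -TD; apply: GM.
  by rewrite intS opprD -TD; apply: GM.
have := GT (k * k); rewrite /T /transvection.
by rewrite [(k *: v)^T]linearZ /= -!scalemxAl -!scalemxAr -!scalemxAl scalerA.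
Qed.

End Transvections.

Section EightTransvections.
Variables (Gam : set 'M[int]_4) (Om P : 'M[int]_4) (c : int).
Hypotheses (sG : subgroup_SL4Z Gam) (GOm : Gam `<=` Sp4Z Om).
Hypotheses (POm : P^T *m Om *m P = c *: J4) (c0 : c != 0).

Let T w := Gam (transvection Om (P *m w)).

Lemma conj_mem_transvection w (X : sp4) : T w ->
  sp4_mx X = 1%:M + c *: (w *m w^T *m J4) -> conj_mem Gam P X.
Proof.
move=> Tw e; exists (transvection Om (P *m w)) => //.
rewrite e /transvection mulmxDl mulmxDr mul1mx mulmx1; congr (_ + _).
by rewrite trmx_mul -!mulmxA (mulmxA P^T) POm -!scalemxAr.
Qed.

Let K := conj_mem Gam P.
Let sK : is_subgroup K := conj_mem_subgroup P sG.

Ltac transvection_ring e :=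
  apply: (conj_mem_transvection e);
  rewrite !sp4_mxM !sp4_mx_root mk4_1 /J4 mul_cvec_tr /root_mx !mk4M mk4Z mk4D;
  congr mk4; ring.

Theorem finite_index_of_transvections a1 b1 a2 b2 a3 b3 a4 b4 :
  a1 * b1 * (a2 * b2) * (a3 * b3) * (a4 * b4) != 0 ->
  T (cvec 1 0 0 0) -> T (cvec 0 1 0 0) -> T (cvec 0 0 1 0) -> T (cvec 0 0 0 1) ->
  T (cvec a1 b1 0 0) -> T (cvec a2 0 0 b2) -> T (cvec 0 a3 b3 0) -> T (cvec 0 0 a4 b4) ->
  finite_index Gam (Sp4Z Om).
Proof.
move=> ab0 Te1 Te2 Tf1 Tf2 T1 T2 T3 T4.
have KE1 : K (root_elt E1 c * 1)%g.
  by rewrite -(root_elt0 E1); transvection_ring Te1.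
have KE2 : K (root_elt E2 c * 1)%g.
  by rewrite -(root_elt0 E1); transvection_ring Te2.
have KF1 : K (root_elt F1 (- c) * 1)%g.
  by rewrite -(root_elt0 E1); transvection_ring Tf1.
have KF2 : K (root_elt F2 (- c) * 1)%g.
  by rewrite -(root_elt0 E1); transvection_ring Tf2.
rewrite !mulg1 in KE1 KE2 KF1 KF2.
rewrite !root_eltN in KF1 KF2; move: KF1 KF2 => /(subgV sK) + /(subgV sK).
rewrite !invgK => KF1 KF2.
have KL r t : K (root_elt r c) -> K (root_elt r (c * t)) by apply: subg_root.
have KE12 : K (root_elt E12 (c * (a1 * b1))).
  have K1 : K (root_elt E1 (c * (a1 * a1)) * root_elt E2 (c * (b1 * b1)) *
                root_elt E12 (c * (a1 * b1)))%g by transvection_ring T1.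
  by have := subgM sK (subgV sK (subgM sK (KL _ (a1 * a1) KE1) (KL _ (b1 * b1) KE2))) K1;
    rewrite mulKg.
have KD12 : K (root_elt D12 (c * - (a2 * b2))).
  have K1 : K (root_elt E1 (c * (a2 * a2)) * root_elt F2 (c * - (b2 * b2)) *
                root_elt D12 (c * - (a2 * b2)))%g by transvection_ring T2.
  by have := subgM sK (subgV sK (subgM sK (KL _ (a2 * a2) KE1) (KL _ (- (b2 * b2)) KF2))) K1;
    rewrite mulKg.
have KD21 : K (root_elt D21 (c * - (a3 * b3))).
  have K1 : K (root_elt E2 (c * (a3 * a3)) * root_elt F1 (c * - (b3 * b3)) *
                root_elt D21 (c * - (a3 * b3)))%g by transvection_ring T3.
  by have := subgM sK (subgV sK (subgM sK (KL _ (a3 * a3) KE2) (KL _ (- (b3 * b3)) KF1))) K1;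
    rewrite mulKg.
have KF12 : K (root_elt F12 (c * - (a4 * b4))).
  have K1 : K (root_elt F1 (c * - (a4 * a4)) * root_elt F2 (c * - (b4 * b4)) *
                root_elt F12 (c * - (a4 * b4)))%g by transvection_ring T4.
  by have := subgM sK (subgV sK (subgM sK (KL _ (- (a4 * a4)) KF1)
                                         (KL _ (- (b4 * b4)) KF2))) K1;
    rewrite mulKg.
pose n := c * (a1 * b1 * (a2 * b2) * (a3 * b3) * (a4 * b4)).
apply: (@finite_index_of_root_elements Gam Om P c sG GOm POm c0 n).
  by rewrite mulf_neq0.
have Kn r s t : K (root_elt r s) -> n = s * t -> K (root_elt r n).
  by move=> Ks ->; apply: subg_root.
case.
- by apply: (Kn _ _ (a1 * b1 * (a2 * b2) * (a3 * b3) * (a4 * b4)) KE1); rewrite /n; ring.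
- by apply: (Kn _ _ (a1 * b1 * (a2 * b2) * (a3 * b3) * (a4 * b4)) KE2); rewrite /n; ring.
- by apply: (Kn _ _ (a2 * b2 * (a3 * b3) * (a4 * b4)) KE12); rewrite /n; ring.
- by apply: (Kn _ _ (- (a1 * b1 * (a3 * b3) * (a4 * b4))) KD12); rewrite /n; ring.
- by apply: (Kn _ _ (a1 * b1 * (a2 * b2) * (a3 * b3) * (a4 * b4)) KF1); rewrite /n; ring.
- by apply: (Kn _ _ (a1 * b1 * (a2 * b2) * (a3 * b3) * (a4 * b4)) KF2); rewrite /n; ring.
- by apply: (Kn _ _ (- (a1 * b1 * (a2 * b2) * (a3 * b3))) KF12); rewrite /n; ring.
- by apply: (Kn _ _ (- (a1 * b1 * (a2 * b2) * (a4 * b4))) KD21); rewrite /n; ring.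
Qed.

End EightTransvections.

Section GeneratedSubgroup.
Variable S : set 'M[int]_4.
Hypothesis S_SL : S `<=` SL4Z.

Lemma SL4Z_subgroup : subgroup_SL4Z SL4Z.
Proof.
split=> // [|M N SM SN|M SM]; first by rewrite /SL4Z /= det1.
  by rewrite /SL4Z /= det_mulmx SM SN mulr1.
by rewrite /SL4Z /= det_inv SM invr1.
Qed.

Lemma generated_subgroup_subgroup : subgroup_SL4Z (generated_subgroup S).
Proof.
split=> [M||M N GM GN|M GM].
- by apply; split; first exact: SL4Z_subgroup.
- by move=> H [[_ H1 _ _] _].
- by move=> H [sH SH]; have [_ _ HM _] := sH; apply: HM; [apply: GM|apply: GN].
- by move=> H [sH SH]; have [_ _ _ HV] := sH; apply: HV; apply: GM.
Qed.

Lemma sub_generated_subgroup : S `<=` generated_subgroup S.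
Proof. by move=> M SM H [_ SH]; apply: SH. Qed.

Lemma generated_subgroup_sub (H : set 'M[int]_4) :
  subgroup_SL4Z H -> S `<=` H -> generated_subgroup S `<=` H.
Proof. by move=> sH SH M; apply. Qed.

End GeneratedSubgroup.

(** * Groups generated by two companion matrices *)

Definition companion_mx (c1 c2 : int) : 'M[int]_4 :=
  mk4 0 0 0 (-1)  1 0 0 (- c1)  0 1 0 (- c2)  0 0 1 (- c1).

Lemma companion4E (h : {poly int}) c1 c2 :
  h`_0 = 1 -> h`_1 = c1 -> h`_2 = c2 -> h`_3 = c1 -> companion4 h = companion_mx c1 c2.
Proof.
move=> h0 h1 h2 h3; apply/matrixP => -[[|[|[|[|i]]]] hi] [[|[|[|[|j]]]] hj] //;
  by rewrite !mxE /= ?h0 ?h1 ?h2 ?h3.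
Qed.

Definition toeplitz_form (x y z : int) : 'M[int]_4 :=
  mk4 0 x y z  (- x) 0 x y  (- y) (- x) 0 x  (- z) (- y) (- x) 0.

Lemma toeplitz_form_alternating x y z : alternating (toeplitz_form x y z).
Proof.
apply: alternating_antisym.
by rewrite -scaleN1r /toeplitz_form mk4T mk4Z; congr mk4; ring.
Qed.

Section Companions.
Variables c1 c2 d1 d2 : int.
Let x := c1 - d1.
Let y := d2 - c2.
Let z := (1 - c2) * x - c1 * y.
Let A := companion_mx c1 c2.
Let B := companion_mx d1 d2.
Hypotheses (SA : SL4Z A) (SB : SL4Z B).
Let Om := toeplitz_form x y z.
Let Gam := generated_subgroup [set A; B].

Lemma companion_generators_SL4Z : [set A; B] `<=` SL4Z.
Proof. by move=> M [->|->]. Qed.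

Lemma companion_group_subgroup : subgroup_SL4Z Gam.
Proof. exact/generated_subgroup_subgroup/companion_generators_SL4Z. Qed.

Lemma companion_group_Sp4Z : Gam `<=` Sp4Z Om.
Proof.
apply: generated_subgroup_sub; first exact: subgroup_SL4Z_Sp4Z.
move=> M [->|->]; split=> //; apply/preservesE; rewrite /A /B /Om /companion_mx
  /toeplitz_form mk4T !mk4M /z /x /y; congr mk4; ring.
Qed.

Lemma mem_companion_A : Gam A.
Proof. by apply: sub_generated_subgroup; left. Qed.

Lemma mem_companion_B : Gam B.
Proof. by apply: sub_generated_subgroup; right. Qed.

Lemma companion_invariant_form_unique Om' :
  alternating Om' -> (forall M, Gam M -> preserves Om' M) ->
  exists x', x *: Om' = x' *: Om.
Proof.
move=> aOm' GOm'.
have [a00 [a01 [a02 [a03 [a10 [a11 [a12 [a13 [a20 [a21 [a22 [a23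
  [a30 [a31 [a32 [a33 e]]]]]]]]]]]]]]]] := mk4_ex Om'.
have anti : Om'^T = (-1) *: Om'.
  by apply/matrixP => i j; rewrite !mxE mulN1r (alternating_entry i j aOm').
rewrite e mk4T mk4Z !mulN1r in anti; move/mk4_inj: anti.
case=> [[h00 h10 h20 h30] [_ h11 h21 h31] [_ _ h22 h32] [_ _ _ h33]].
have {}h00 : a00 = 0 by lia.
have {}h11 : a11 = 0 by lia.
have {}h22 : a22 = 0 by lia.
have {}h33 : a33 = 0 by lia.
have /preservesE eA := GOm' _ mem_companion_A.
have /preservesE eB := GOm' _ mem_companion_B.
move: eA eB; rewrite e h00 h11 h22 h33 h10 h20 h30 h21 h31 h32 /A /B /companion_mx !mk4T !mk4M.
rewrite !(mul0r, mulr0, add0r, addr0, mul1r, mulr1).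
move=> /mk4_inj[[_ e12 e13 zA] [_ _ e23 _] _ _] /mk4_inj[[_ _ _ zB] _ _ _].
rewrite e23 e12 e13 in zA zB *.
have xy : x * a02 = a01 * y.
  apply/eqP; rewrite -subr_eq0; apply/eqP.
  by rewrite -(subrr a03) -{1}zB -zA /x /y; ring.
have xz : x * a03 = a01 * z.
  have -> : a01 * z = (1 - c2) * (x * a01) - c1 * (x * a02) by rewrite xy /z; ring.
  by rewrite -zA; ring.
exists a01; rewrite /Om /toeplitz_form !mk4Z.
by congr mk4; rewrite ?mulr0 ?mulrN ?xy ?xz // mulrC.
Qed.

(* [A^-1 B] is 1 plus a matrix of rank one; its power by [x z - y^2 + x^2] is a transvection
   with respect to [Om]. *)
Lemma companion_transvection : Gam (transvection Om (cvec x (- y) x 0)).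
Proof.
have [GS G1 GM GV] := companion_group_subgroup.
pose L k := mk4 1 0 0 (k * x)  0 1 0 (- (k * y))  0 0 1 (k * x)  0 0 0 1.
have LD k l : L k *m L l = L (k + l) by rewrite /L mk4M; congr mk4; ring.
have GL1 : Gam (L 1).
  rewrite (_ : L 1 = invmx A *m B); first exact: GM (GV _ mem_companion_A) mem_companion_B.
  have -> : B = A *m L 1 by rewrite /A /B /L /companion_mx mk4M /x /y; congr mk4; ring.
  by rewrite mulmxA mulVmx ?mul1mx // SL4Z_unit.
have L0 : L 0 = 1%:M by rewrite /L mk4_1 !mul0r oppr0.
have GLm : Gam (L (-1)).
  rewrite (_ : L (-1) = invmx (L 1)); first exact: GV.
  have u1 := SL4Z_unit (GS _ GL1).
  by rewrite -[LHS](mulmxK u1) LD addNr L0 mul1mx.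
have GL k : Gam (L k).
  elim/int_rec: k => [|k Gk|k Gk]; first by rewrite L0.
    by rewrite intS -LD; apply: GM.
  by rewrite intS opprD -LD; apply: GM.
suff -> : transvection Om (cvec x (- y) x 0) = L (x * z - y * y + x * x) by [].
rewrite /transvection mul_cvec_tr /Om /toeplitz_form mk4M mk4_1 mk4D /L.
by congr mk4; ring.
Qed.

End Companions.

(** * Certificates *)

Definition Zvec : Type := (Z * Z * Z * Z)%type.

Definition to_cvec (v : Zvec) : 'cV[int]_4 :=
  let: (v0, v1, v2, v3) := v in
  cvec (int_of_Z v0) (int_of_Z v1) (int_of_Z v2) (int_of_Z v3).

Definition Zvec_scale (k : Z) (v : Zvec) : Zvec :=
  let: (v0, v1, v2, v3) := v in (k * v0, k * v1, k * v2, k * v3).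

Definition Zvec_add (v w : Zvec) : Zvec :=
  let: (v0, v1, v2, v3) := v in let: (w0, w1, w2, w3) := w in
  (v0 + w0, v1 + w1, v2 + w2, v3 + w3).

Definition Zvec_eqb (v w : Zvec) : bool :=
  let: (v0, v1, v2, v3) := v in let: (w0, w1, w2, w3) := w in
  [&& Z.eqb v0 w0, Z.eqb v1 w1, Z.eqb v2 w2 & Z.eqb v3 w3].

Definition Zform (x y z : Z) (v w : Zvec) : Z :=
  let: (v0, v1, v2, v3) := v in let: (w0, w1, w2, w3) := w in
  x * (v0 * w1 - v1 * w0 + (v1 * w2 - v2 * w1) + (v2 * w3 - v3 * w2)) +
  y * (v0 * w2 - v2 * w0 + (v1 * w3 - v3 * w1)) + z * (v0 * w3 - v3 * w0).

Definition companion_act (c1 c2 : Z) (v : Zvec) : Zvec :=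
  let: (v0, v1, v2, v3) := v in (- v3, v0 - c1 * v3, v1 - c2 * v3, v2 - c1 * v3).

Definition companion_inv_act (c1 c2 : Z) (v : Zvec) : Zvec :=
  let: (v0, v1, v2, v3) := v in (v1 - c1 * v0, v2 - c2 * v0, v3 - c1 * v0, - v0).

Definition companion_pow_act (c1 c2 e : Z) : Zvec -> Zvec :=
  ssrnat.iter (Z.abs_nat e)
    (if Z.ltb e Z0 then companion_inv_act c1 c2 else companion_act c1 c2).

(* The word with exponents [:: e1; e2; e3; ...] is A^e1 B^e2 A^e3 ... *)
Fixpoint word_act (c1 c2 d1 d2 : Z) (es : seq Z) (v : Zvec) : Zvec :=
  if es is e :: es' then companion_pow_act c1 c2 e (word_act d1 d2 c1 c2 es' v) else v.

Definition orbit_vector (c1 c2 d1 d2 : Z) (kw : Z * seq Z) : Zvec :=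
  Zvec_scale kw.1
    (word_act c1 c2 d1 d2 kw.2 (c1 - d1, - (d2 - c2), c1 - d1, 0)).

(* A symplectic basis e1, e2, f1, f2 up to scale, each vector being a multiple [k * word.u]
   of an element of the orbit of u, and four vectors [a * e1 + b * e2], [a * e1 + b * f2],
   [a * e2 + b * f1], [a * f1 + b * f2] of the same kind. *)
Definition certificate : Type :=
  (seq (Z * seq Z) * seq (Z * Z * (Z * seq Z)))%type.

Definition valid_certificate (c1 c2 d1 d2 : Z) (cert : certificate) : bool :=
  if cert is ([:: be1; be2; bf1; bf2],
              [:: (a1, b1, t1); (a2, b2, t2); (a3, b3, t3); (a4, b4, t4)]) then
    let x := c1 - d1 in
    let y := d2 - c2 in
    let z := (1 - c2) * x - c1 * y in
    let vec := orbit_vector c1 c2 d1 d2 in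
    let e1 := vec be1 in let e2 := vec be2 in
    let f1 := vec bf1 in let f2 := vec bf2 in
    let form := Zform x y z in
    let third a v b w t := Zvec_eqb (Zvec_add (Zvec_scale a v) (Zvec_scale b w)) (vec t) in
    [&& ~~ Z.eqb x 0, ~~ Z.eqb (form e1 f1) 0,
        ~~ Z.eqb (a1 * b1 * (a2 * b2) * (a3 * b3) * (a4 * b4)) 0
      & [&& Z.eqb (form e2 f2) (form e1 f1), Z.eqb (form e1 e2) 0, Z.eqb (form e1 f2) 0,
            Z.eqb (form e2 f1) 0 & Z.eqb (form f1 f2) 0]] &&
    [&& third a1 e1 b1 e2 t1, third a2 e1 b2 f2 t2, third a3 e2 b3 f1 t3
      & third a4 f1 b4 f2 t4]
  else false.

Lemma to_cvec_scale k v : to_cvec (Zvec_scale k v) = int_of_Z k *: to_cvec v.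
Proof.
case: v => [[[v0 v1] v2] v3]; apply/matrixP => -[[|[|[|[|i]]]] hi] j //;
  by rewrite !mxE /= rmorphM.
Qed.

Lemma to_cvec_add v w : to_cvec (Zvec_add v w) = to_cvec v + to_cvec w.
Proof.
case: v w => [[[v0 v1] v2] v3] [[[w0 w1] w2] w3].
by apply/matrixP => -[[|[|[|[|i]]]] hi] j //; rewrite !mxE /= rmorphD.
Qed.

Lemma Zvec_eqP v w : Zvec_eqb v w -> v = w.
Proof.
by case: v w => [[[v0 v1] v2] v3] [[[w0 w1] w2] w3] /and4P[/Z.eqb_eq -> /Z.eqb_eq ->
  /Z.eqb_eq -> /Z.eqb_eq ->].
Qed.

Lemma bform_Zform x y z v w :
  bform (toeplitz_form (int_of_Z x) (int_of_Z y) (int_of_Z z)) (to_cvec v) (to_cvec w) =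
  int_of_Z (Zform x y z v w).
Proof.
case: v w => [[[v0 v1] v2] v3] [[[w0 w1] w2] w3].
rewrite /bform /toeplitz_form -mulmxA mul_mk4_cvec mxE !big_ord_recr big_ord0 /= !mxE /=.
by rewrite !(rmorphD, rmorphB, rmorphM); ring.
Qed.

Lemma Zform_anti x y z v w : Zform x y z v w = - Zform x y z w v.
Proof.
by case: v w => [[[v0 v1] v2] v3] [[[w0 w1] w2] w3]; rewrite /Zform; ring.
Qed.

Lemma Zform_diag x y z v : Zform x y z v v = 0.
Proof. by case: v => [[[v0 v1] v2] v3]; rewrite /Zform; ring. Qed.

Lemma companion_act_mul c1 c2 v :
  to_cvec (companion_act c1 c2 v) = companion_mx (int_of_Z c1) (int_of_Z c2) *m to_cvec v.
Proof.
case: v => [[[v0 v1] v2] v3]; rewrite /companion_mx mul_mk4_cvec /=.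
by rewrite !(rmorphB, rmorphN, rmorphM); congr cvec; ring.
Qed.

Lemma companion_inv_actK c1 c2 v : companion_act c1 c2 (companion_inv_act c1 c2 v) = v.
Proof. by case: v => [[[v0 v1] v2] v3] /=; congr (_, _, _, _); ring. Qed.

Lemma int_of_Z_neq0 k : ~~ Z.eqb k 0 -> int_of_Z k != 0.
Proof.
apply: contraNneq => k0; apply/Z.eqb_eq; apply: (can_inj int_of_ZK).
by rewrite k0.
Qed.

Section Orbit.
Variables c1 c2 d1 d2 : Z.
Let A := companion_mx (int_of_Z c1) (int_of_Z c2).
Let B := companion_mx (int_of_Z d1) (int_of_Z d2).
Variables (T : 'cV[int]_4 -> Prop).
Hypotheses (TA : forall v, T v -> T (A *m v)) (TB : forall v, T v -> T (B *m v)).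
Hypotheses (TAV : forall v, T (A *m v) -> T v) (TBV : forall v, T (B *m v) -> T v).

Lemma companion_pow_act_mem (a1 a2 e : Z) v :
  (forall v, T v -> T (companion_mx (int_of_Z a1) (int_of_Z a2) *m v)) ->
  (forall v, T (companion_mx (int_of_Z a1) (int_of_Z a2) *m v) -> T v) ->
  T (to_cvec v) -> T (to_cvec (companion_pow_act a1 a2 e v)).
Proof.
move=> Tm TmV Tv; rewrite /companion_pow_act; elim: (Z.abs_nat e) => //= n IHn.
case: (Z.ltb e 0) in IHn *; last by rewrite companion_act_mul; apply: Tm.
by apply: TmV; rewrite -companion_act_mul companion_inv_actK.
Qed.

Lemma word_act_mem es v : T (to_cvec v) -> T (to_cvec (word_act c1 c2 d1 d2 es v)).
Proof.
move=> Tv; suff [] : T (to_cvec (word_act c1 c2 d1 d2 es v)) /\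
  T (to_cvec (word_act d1 d2 c1 c2 es v)) by [].
by elim: es => [//|e es [IH1 IH2]]; split; apply: companion_pow_act_mem.
Qed.

End Orbit.

Lemma columns_mul (e1 e2 f1 f2 : Zvec) :
  exists P, forall a b c d, P *m cvec a b c d =
  a *: to_cvec e1 + b *: to_cvec e2 + c *: to_cvec f1 + d *: to_cvec f2.
Proof.
case: e1 e2 f1 f2 => [[[e10 e11] e12] e13] [[[e20 e21] e22] e23]
  [[[f10 f11] f12] f13] [[[f20 f21] f22] f23].
pose i := int_of_Z.
exists (mk4 (i e10) (i e20) (i f10) (i f20) (i e11) (i e21) (i f11) (i f21)
            (i e12) (i e22) (i f12) (i f22) (i e13) (i e23) (i f13) (i f23)) => a' b' c' d'.
rewrite mul_mk4_cvec; apply/matrixP => -[[|[|[|[|k]]]] hk] j //;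
  by rewrite !mxE /= ![i _ * _]mulrC.
Qed.

Theorem valid_certificate_finite_index (c1 c2 d1 d2 : Z) (cert : certificate) :
  let A := companion_mx (int_of_Z c1) (int_of_Z c2) in
  let B := companion_mx (int_of_Z d1) (int_of_Z d2) in
  let Gam := generated_subgroup [set A; B] in
  SL4Z A -> SL4Z B -> valid_certificate c1 c2 d1 d2 cert ->
  (exists Om, invariant_symplectic_form Gam Om) /\
  (forall Om, invariant_symplectic_form Gam Om -> finite_index Gam (Sp4Z Om)).
Proof.
move=> A B Gam SA SB; rewrite /valid_certificate.
case: cert => [[|be1 [|be2 [|bf1 [|bf2 [|//]]]]]] [|[[a1 b1] t1] [|[[a2 b2] t2]
  [|[[a3 b3] t3] [|[[a4 b4] t4] [|//]]]]] //=.
set x := c1 - d1; set y := d2 - c2; set z := (1 - c2) * x - c1 * y.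
set vec := orbit_vector c1 c2 d1 d2.
set e1 := vec be1; set e2 := vec be2; set f1 := vec bf1; set f2 := vec bf2.
move=> /andP[/and4P[x0 c0 ab0 /and5P[/Z.eqb_eq e2f2 /Z.eqb_eq e1e2 /Z.eqb_eq e1f2
  /Z.eqb_eq e2f1 /Z.eqb_eq f1f2]]].
move=> /and4P[/Zvec_eqP v1 /Zvec_eqP v2 /Zvec_eqP v3 /Zvec_eqP v4].
pose Om := toeplitz_form (int_of_Z x) (int_of_Z y) (int_of_Z z).
have OmE : Om = toeplitz_form (int_of_Z c1 - int_of_Z d1) (int_of_Z d2 - int_of_Z c2)
    ((1 - int_of_Z c2) * (int_of_Z c1 - int_of_Z d1) -
     int_of_Z c1 * (int_of_Z d2 - int_of_Z c2)).
  by rewrite /Om /z /x /y !(rmorphB, rmorphM, rmorph1).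
have sG : subgroup_SL4Z Gam := companion_group_subgroup SA SB.
have GOm : Gam `<=` Sp4Z Om by rewrite OmE; apply: companion_group_Sp4Z.
have aOm : alternating Om := toeplitz_form_alternating _ _ _.
pose T v := Gam (transvection Om v).
have GA : Gam A by apply: mem_companion_A.
have GB : Gam B by apply: mem_companion_B.
have TG M v : Gam M -> T v -> T (M *m v) by apply: transvection_conj.
have TGV M v : Gam M -> T (M *m v) -> T v.
  move=> GM /(TG (invmx M)); have [GS _ _ GV] := sG.
  by rewrite mulmxA mulVmx ?mul1mx; [apply; apply: GV|apply/SL4Z_unit/GS].
have Tu : T (to_cvec (x, - y, x, 0)).
  have := companion_transvection SA SB; rewrite -OmE /T /= /x /y.
  by rewrite !(rmorphB, rmorphN, rmorph0).
have Tvec kw : T (to_cvec (vec kw)).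
  rewrite /vec /orbit_vector to_cvec_scale; apply: (transvection_scale sG aOm).
  by apply: (word_act_mem (T := T)) => // v; [exact: TG|exact: TG|exact: TGV|exact: TGV].
have [P PE] := columns_mul e1 e2 f1 f2.
pose c := int_of_Z (Zform x y z e1 f1).
have POm : P^T *m Om *m P = c *: J4.
  apply/matrixP => i j; rewrite -bform_delta.
  have -> : bform (P^T *m Om *m P) (delta_mx i 0) (delta_mx j 0) =
            bform Om (P *m delta_mx i 0) (P *m delta_mx j 0).
    by rewrite /bform trmx_mul !mulmxA.
  pose b k := nth e1 [:: e1; e2; f1; f2] k.
  have Pb (k : 'I_4) : P *m delta_mx k 0 = to_cvec (b k).
    have -> : delta_mx k 0 = cvec (k == 0 :> nat)%:R (k == 1 :> nat)%:R
                                  (k == 2 :> nat)%:R (k == 3 :> nat)%:R.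
      apply/matrixP => -[[|[|[|[|l]]]] hl] m //; rewrite !mxE (ord1 m) andbT /=;
        by rewrite eq_sym.
    rewrite PE; case: k => -[|[|[|[|k]]]] hk //=;
      by rewrite ?scale0r ?scale1r ?add0r ?addr0.
  rewrite !Pb bform_Zform [RHS]mxE.
  case: i j => -[|[|[|[|i]]]] hi // [[|[|[|[|j]]]] hj] //;
    rewrite ?mxE /b /= ?Zform_diag ?e1e2 ?e1f2 ?e2f1 ?f1f2 ?e2f2 ?mulr0 ?mulr1 ?rmorph0 //;
    rewrite Zform_anti ?e1e2 ?e1f2 ?e2f1 ?f1f2 ?e2f2 ?oppr0 ?mulrN1 ?rmorphN ?rmorph0 //.
have dOm : \det Om != 0 by have [] := symplectic_basis_det POm (int_of_Z_neq0 c0).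
have fG : finite_index Gam (Sp4Z Om).
  have := @finite_index_of_transvections Gam Om P c sG GOm POm (int_of_Z_neq0 c0).
  move/(_ (int_of_Z a1) (int_of_Z b1) (int_of_Z a2) (int_of_Z b2)
          (int_of_Z a3) (int_of_Z b3) (int_of_Z a4) (int_of_Z b4)).
  have abn : int_of_Z a1 * int_of_Z b1 * (int_of_Z a2 * int_of_Z b2) *
      (int_of_Z a3 * int_of_Z b3) * (int_of_Z a4 * int_of_Z b4) != 0.
    by have := int_of_Z_neq0 ab0; rewrite !rmorphM.
  by apply=> //; rewrite PE ?scale0r ?scale1r ?add0r ?addr0
    -?to_cvec_scale -?to_cvec_add ?v1 ?v2 ?v3 ?v4; apply: Tvec.
have pG M : Gam M -> preserves Om M by move=> /GOm[].
split=> [|Om' [aOm' nOm' pOm']].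
  by exists Om; split=> //; apply: nondegenerate_det.
have [x' xx'] := companion_invariant_form_unique aOm' pOm'.
have x0' := int_of_Z_neq0 x0; rewrite rmorphB in x0'.
have x'0 : x' != 0.
  apply: contraTneq (nondegenerate_neq0 nOm') => x'0; rewrite negbK.
  by rewrite x'0 scale0r in xx'; apply/eqP; apply: (scalemx_inj x0'); rewrite xx' scaler0.
by rewrite (Sp4Z_scale x0' x'0 xx') -OmE.
Qed.

Lemma hypergeometric_group_finite_index (f g : {poly int}) (c1 c2 d1 d2 : Z) cert :
  [&& f`_0 == 1, f`_1 == int_of_Z c1, f`_2 == int_of_Z c2 & f`_3 == int_of_Z c1] ->
  [&& g`_0 == 1, g`_1 == int_of_Z d1, g`_2 == int_of_Z d2 & g`_3 == int_of_Z d1] ->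
  valid_certificate c1 c2 d1 d2 cert ->
  (exists Om, invariant_symplectic_form (hypergeometric_group f g) Om) /\
  (forall Om, invariant_symplectic_form (hypergeometric_group f g) Om ->
     finite_index (hypergeometric_group f g) (Sp4Z Om)).
Proof.
move=> /and4P[/eqP f0 /eqP f1 /eqP f2 /eqP f3] /and4P[/eqP g0 /eqP g1 /eqP g2 /eqP g3].
have := companion4_SL4Z f0; have := companion4_SL4Z g0.
rewrite /hypergeometric_group (companion4E f0 f1 f2 f3) (companion4E g0 g1 g2 g3).
by move=> SB SA; apply: valid_certificate_finite_index.
Qed.

Local Open Scope Z_scope.

(* Found by enumerating the orbit of u by word length.  Numbers 9 to 15 come from 1 to 8 by
   X -> -X, which replaces (A, B) by (-B, -A), or by (-A, -B) for 15, up to conjugation. *)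
Definition certificate1 : certificate :=
  ([:: (1, [::]);
      (-1, [:: 2; 4; 1]);
      (1, [:: 0; 3; -1; -2; 2]);
      (1, [:: 1; 2; 2])],
   [:: (9, 2, (1, [:: -1; -2; -2; -2]));
      (-6, -1, (1, [:: -2; -2; -1]));
      (3, -5, (4, [:: 0; 3; -1; 1; -1]));
      (-3, 2, (1, [:: 0; 3; -1; 1; -1; 1; -1; 3; 1; 2; 1]))]).

Definition certificate2 : certificate :=
  ([:: (1, [::]);
      (1, [:: 2; -1; 5; -1; 2; -1; -3]);
      (1, [:: 0; 1; 1]);
      (1, [:: 4; -1; 1; 1; -1; 1; 4])],
   [:: (1, 2, (1, [:: 0; 1; -2; -1; -1; 2; 4; -1]));
      (1, 2, (1, [:: 2; -1; -3]));
      (-1, 2, (1, [:: 0; 1; -2; -1; -2; 2; -4; -1]));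
      (1, -2, (1, [:: 0; 1; -2; 1; 4]))]).

Definition certificate3 : certificate :=
  ([:: (2, [::]);
      (-1, [:: 0; 1; 1; 3; -1; 1; 2; -1; 1; -1; 4; 1; -1; 1; -4]);
      (1, [:: 0; 1; 4; 1; -1; 1; -4]);
      (1, [:: 1; 2; -1; 1; 4; -1; 1; -1; -4; 1; -1; 1; -1; 1; -1])],
   [:: (7, -4, (6, [:: 1; 1; -4]));
      (-3, -8, (2, [:: 0; 1; 1; 1; -5; 1; 3; -1; 1; -1; 5]));
      (8, 1, (1, [:: 0; 1; 1; -2; 1; -1; -1; 1; -1; 1; 4; -1; 3]));
      (-1, -4, (3, [:: -1; -1; 5; -1; -4; 1; -2; 1; -4]))]).

Definition certificate4 : certificate :=
  ([:: (1, [::]);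
      (-1, [:: 1; -3; -1; -3]);
      (1, [:: 4; 1; -7]);
      (1, [:: 4])],
   [:: (-6, 1, (1, [:: -1; -1; 8]));
      (-5, -1, (1, [:: -1; -3]));
      (-3, -1, (5, [:: 0; 1; 1]));
      (-1, -6, (1, [:: 2; 3; 1; 3; 1]))]).

Definition certificate5 : certificate :=
  ([:: (1, [::]);
      (2, [:: 1; 1; 1; -1; 1; -3; -1; -2]);
      (1, [:: 0; 2; -1; -1; 1; 6; -1]);
      (1, [:: 0; 5; 1])],
   [:: (1, 1, (1, [:: 1; 6; -1]));
      (2, -1, (1, [:: 2; -1; -3]));
      (-1, 1, (1, [:: 0; 2; -1; -1]));
      (-1, -2, (1, [:: 0; 2; 2; 2; 1]))]).

Definition certificate6 : certificate :=
  ([:: (1, [::]);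
      (1, [:: -3; -2; -3]);
      (1, [:: 1; 1; -1; -2; -3]);
      (1, [:: 2; -1; 4; 1; 4])],
   [:: (-1, -1, (1, [:: 2; -2; -3]));
      (-1, -1, (1, [:: 0; 1; -2; -1; 4; -1]));
      (-1, 3, (1, [:: -3; 1; -1; -1; -3]));
      (-4, 1, (3, [:: -2]))]).

Definition certificate7 : certificate :=
  ([:: (1, [::]);
      (-1, [:: -1; -1; 1; -4; 1; 2; 1]);
      (1, [:: 1; -4; 2]);
      (1, [:: 0; 5; 1])],
   [:: (2, 1, (1, [:: 0; 2; 1; -4; 1; -1]));
      (-6, 7, (1, [:: 0; 1; 1; 6; -1; -1]));
      (1, -1, (2, [:: 0; -2]));
      (1, 2, (1, [:: 0; -3; -1; 1; -1; -1; 1; -3]))]).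

Definition certificate8 : certificate :=
  ([:: (1, [::]);
      (-1, [:: 0; 2; -5; -1; -3]);
      (1, [:: -2]);
      (1, [:: -1; -1; -2; -1; -4])],
   [:: (3, 4, (1, [:: 0; 1; 4; 1; 1]));
      (7, -3, (2, [:: 1; 1; 3; 1; -4]));
      (4, 3, (1, [:: 0; 1; 2; 1; 3]));
      (2, -3, (1, [:: 0; 1; 5; 2; 4]))]).

Definition certificate9 : certificate :=
  ([:: (1, [::]);
      (-1, [:: 0; 2; 4; 1]);
      (1, [:: 3; -1; -2; 2]);
      (1, [:: 0; 1; 2; 2])],
   [:: (-9, 2, (1, [:: 0; -1; -2; -2; -2]));
      (6, -1, (1, [:: 0; -2; -2; -1]));
      (-3, -5, (4, [:: 3; -1; 1; -1]));
      (3, 2, (1, [:: 3; -1; 1; -1; 1; -1; 3; 1; 2; 1]))]).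

Definition certificate10 : certificate :=
  ([:: (1, [::]);
      (1, [:: 0; 2; -1; 5; -1; 2; -1; -3]);
      (1, [:: 1; 1]);
      (1, [:: 0; 4; -1; 1; 1; -1; 1; 4])],
   [:: (1, -2, (1, [:: 1; -2; -1; -1; 2; 4; -1]));
      (1, -2, (1, [:: 0; 2; -1; -3]));
      (-1, -2, (1, [:: 1; -2; -1; -2; 2; -4; -1]));
      (1, 2, (1, [:: 1; -2; 1; 4]))]).

Definition certificate11 : certificate :=
  ([:: (2, [::]);
      (1, [:: 1; 1; 3; -1; 1; 2; -1; 1; -1; 4; 1; -1; 1; -4]);
      (1, [:: 1; 4; 1; -1; 1; -4]);
      (1, [:: 0; 1; 2; -1; 1; 4; -1; 1; -1; -4; 1; -1; 1; -1; 1; -1])],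
   [:: (7, -4, (6, [:: 0; 1; 1; -4]));
      (-3, -8, (2, [:: 1; 1; 1; -5; 1; 3; -1; 1; -1; 5]));
      (8, 1, (1, [:: 1; 1; -2; 1; -1; -1; 1; -1; 1; 4; -1; 3]));
      (-1, -4, (3, [:: 0; -1; -1; 5; -1; -4; 1; -2; 1; -4]))]).

Definition certificate12 : certificate :=
  ([:: (1, [::]);
      (-2, [:: 0; 1; 1; 1; -1; 1; -3; -1; -2]);
      (1, [:: 2; -1; -1; 1; 6; -1]);
      (1, [:: 5; 1])],
   [:: (1, 1, (1, [:: 0; 1; 6; -1]));
      (2, -1, (1, [:: 0; 2; -1; -3]));
      (-1, 1, (1, [:: 2; -1; -1]));
      (1, 2, (1, [:: 2; 2; 2; 1]))]).

Definition certificate13 : certificate :=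
  ([:: (1, [::]);
      (1, [:: 0; -3; -2; -3]);
      (1, [:: 0; 1; 1; -1; -2; -3]);
      (1, [:: 0; 2; -1; 4; 1; 4])],
   [:: (1, 1, (1, [:: 0; 2; -2; -3]));
      (1, 1, (1, [:: 1; -2; -1; 4; -1]));
      (1, -3, (1, [:: 0; -3; 1; -1; -1; -3]));
      (-4, 1, (3, [:: 0; -2]))]).

Definition certificate14 : certificate :=
  ([:: (1, [::]);
      (-1, [:: 0; -1; -1; 1; -4; 1; 2; 1]);
      (1, [:: 0; 1; -4; 2]);
      (1, [:: 5; 1])],
   [:: (-2, 1, (1, [:: 2; 1; -4; 1; -1]));
      (-6, 7, (1, [:: 1; 1; 6; -1; -1]));
      (-1, 1, (2, [:: -2]));
      (1, -2, (1, [:: -3; -1; 1; -1; -1; 1; -3]))]).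

Definition certificate15 : certificate :=
  ([:: (1, [::]);
      (-1, [:: 0; 2; -5; -1; -3]);
      (1, [:: -2]);
      (1, [:: -1; -1; -2; -1; -4])],
   [:: (-3, 4, (1, [:: 0; 1; 4; 1; 1]));
      (7, 3, (2, [:: 1; 1; 3; 1; -4]));
      (4, -3, (1, [:: 0; 1; 2; 1; 3]));
      (2, 3, (1, [:: 0; 1; 5; 2; 4]))]).

Local Close Scope Z_scope.

Theorem theorem1p3 (f g : {poly int}) (fg : (f, g) \in hypergeometric_pairs) :
  (exists Om : 'M[int]_4,
      invariant_symplectic_form (hypergeometric_group f g) Om) /\
  (forall Om : 'M[int]_4,
      invariant_symplectic_form (hypergeometric_group f g) Om ->
      finite_index (hypergeometric_group f g) (Sp4Z Om)).
Proof.
have main := hypergeometric_group_finite_index.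
move: fg; rewrite !inE.
case/orP=> [/eqP[-> ->]|]; first by
  apply: (main _ _ 3 4 0 2 certificate1); rewrite ?coefE.
case/orP=> [/eqP[-> ->]|]; first by
  apply: (main _ _ 2 3 (- 2) 2 certificate2); rewrite ?coefE.
case/orP=> [/eqP[-> ->]|]; first by
  apply: (main _ _ 2 3 (- 3) 4 certificate3); rewrite ?coefE.
case/orP=> [/eqP[-> ->]|]; first by
  apply: (main _ _ 2 3 (- 2) 3 certificate4); rewrite ?coefE.
case/orP=> [/eqP[-> ->]|]; first by
  apply: (main _ _ 2 3 (- 1) 2 certificate5); rewrite ?coefE.
case/orP=> [/eqP[-> ->]|]; first by
  apply: (main _ _ 2 3 (- 1) 1 certificate6); rewrite ?coefE.
case/orP=> [/eqP[-> ->]|]; first by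
  apply: (main _ _ 3 4 (- 1) 2 certificate7); rewrite ?coefE.
case/orP=> [/eqP[-> ->]|]; first by
  apply: (main _ _ 3 4 0 (- 1) certificate8); rewrite ?coefE.
case/orP=> [/eqP[-> ->]|]; first by
  apply: (main _ _ 0 2 (- 3) 4 certificate9); rewrite ?coefE.
case/orP=> [/eqP[-> ->]|]; first by
  apply: (main _ _ 2 2 (- 2) 3 certificate10); rewrite ?coefE.
case/orP=> [/eqP[-> ->]|]; first by
  apply: (main _ _ 3 4 (- 2) 3 certificate11); rewrite ?coefE.
case/orP=> [/eqP[-> ->]|]; first by
  apply: (main _ _ 1 2 (- 2) 3 certificate12); rewrite ?coefE.
case/orP=> [/eqP[-> ->]|]; first by
  apply: (main _ _ 1 1 (- 2) 3 certificate13); rewrite ?coefE.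
case/orP=> [/eqP[-> ->]|]; first by
  apply: (main _ _ 1 2 (- 3) 4 certificate14); rewrite ?coefE.
move=> /eqP[-> ->]; by apply: (main _ _ (- 3) 4 0 (- 1) certificate15); rewrite ?coefE.
Qed.
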